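(* Assume the setting described in the context, with $n=m$. Let $\bar{\boldsymbol\varsigma}$ be a critical point of the canonical dual function $\Pi^d$ (i.e. $\nabla\Pi^d(\bar{\boldsymbol\varsigma})=0$), and let $\bar{\mathbf x}=[G(\bar{\boldsymbol\varsigma})]^{-1}F(\bar{\boldsymbol\varsigma})$. (i) If $\bar{\boldsymbol\varsigma}\in\mathcal S_a^+$, then $\bar{\boldsymbol\varsigma}$ is a global maximizer of $\Pi^d$ on $\mathcal S_a^+$ if and only if $\bar{\mathbf x}$ is a global minimizer of $\Pi$ on $\mathbb R^n$, i.e. $$\Pi(\bar{\mathbf x})=\min_{\mathbf x\in\mathbb R^n}\Pi(\mathbf x)\iff \max_{\boldsymbol\varsigma\in\mathcal S_a^+}\Pi^d(\boldsymbol\varsigma)=\Pi^d(\bar{\boldsymbol\varsigma}).$$ (ii) If $\bar{\boldsymbol\varsigma}\in\mathcal S_a^-$, then there exists a neighborhood $\mathcal X_o\times\mathcal S_o\subset\mathbb R^n\times\mathcal S_a^-$ of $(\bar{\mathbf x},\bar{\boldsymbol\varsigma})$ such that we have either the double-min duality statement $$\Pi(\bar{\mathbf x})=\min_{\mathbf x\in\mathcal X_o}\Pi(\mathbf x)\iff\min_{\boldsymbol\varsigma\in\mathcal S_o}\Pi^d(\boldsymbol\varsigma)=\Pi^d(\bar{\boldsymbol\varsigma}),$$ or the double-max duality statement $$\Pi(\bar{\mathbf x})=\max_{\mathbf x\in\mathcal X_o}\Pi(\mathbf x)\iff\max_{\boldsymbol\varsigma\in\mathcal S_o}\Pi^d(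\boldsymbol\varsigma)=\Pi^d(\bar{\boldsymbol\varsigma}).$$
   Context: Let $A\in\mathbb R^{n\times n}$ be symmetric, $\mathbf f\in\mathbb R^n$, and for $k=1,\dots,m$ let $B^k\in\mathbb R^{n\times n}$ be symmetric and $\mathbf b_k\in\mathbb R^n$. Define the operator $\Lambda:\mathbb R^n\to\mathbb R^m$, $\Lambda(\mathbf x)=\big(\tfrac12\mathbf x^TB^k\mathbf x+\mathbf b_k^T\mathbf x\big)_{k=1}^m$, and let $V:\mathbb R^m\to\mathbb R$ be a strictly convex, twice continuously differentiable function. The primal function is $\Pi(\mathbf x)=V(\Lambda(\mathbf x))+\tfrac12\mathbf x^TA\mathbf x-\mathbf x^T\mathbf f$ on $\mathbb R^n$. Standing assumption: every critical point of $\Pi$ is non-singular, i.e. $\nabla\Pi(\bar{\mathbf x})=0$ implies $\det\nabla^2\Pi(\bar{\mathbf x})\neq0$. Let $\mathcal V_a=\{\Lambda(\mathbf x):\mathbf x\in\mathbb R^n\}$, $\mathcal V_a^*=\{\nabla V(\boldsymbol\xi):\boldsymbol\xi\in\mathcal V_a\}$, and let $V^*:\mathcal V_a^*\to\mathbb R$ be the Legendre conjugate $V^*(\boldsymbol\varsigma)=\langle\boldsymbol\xi,\boldsymbol\varsigma\rangle-V(\boldsymbol\xi)$ where $\boldsymbol\varsigma=\nabla V(\boldsymbol\xi)$. Define $G(\boldsymbol\varsigma)=A+\sum_{k=1}^m\varsigma_kB^k$ and $F(\boldsymbol\varsigma)=\mathbf f-\sum_{k=1}^m\varsigma_k\mathbf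 b_k$; $[G(\boldsymbol\varsigma)]^{-1}$ denotes a generalized inverse when $G(\boldsymbol\varsigma)$ is singular. The dual feasible set is $\mathcal S_a=\{\boldsymbol\varsigma\in\mathcal V_a^*: F(\boldsymbol\varsigma)$ lies in the column space of $G(\boldsymbol\varsigma)\}$, and the canonical dual function is $\Pi^d(\boldsymbol\varsigma)=-\tfrac12\langle[G(\boldsymbol\varsigma)]^{-1}F(\boldsymbol\varsigma),F(\boldsymbol\varsigma)\rangle-V^*(\boldsymbol\varsigma)$ on $\mathcal S_a$. Set $\mathcal S_a^+=\{\boldsymbol\varsigma\in\mathcal S_a: G(\boldsymbol\varsigma)\succeq0\}$ and $\mathcal S_a^-=\{\boldsymbol\varsigma\in\mathcal S_a: G(\boldsymbol\varsigma)\prec0\}$ (positive semidefinite, resp. negative definite). *)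

(* Defs.v *)
From HB Require Import structures.
From mathcomp Require Import all_boot all_order all_algebra.
From mathcomp Require Import all_classical all_reals all_analysis.
Set Implicit Arguments. Unset Strict Implicit. Unset Printing Implicit Defensive.
Import Order.TTheory GRing.Theory Num.Theory.
Import numFieldNormedType.Exports.
Local Open Scope classical_set_scope.
Local Open Scope ring_scope.

Section Defs.
Variables (R : realType) (n : nat).

Definition dotv (u v : 'cV[R]_n) : R := (u^T *m v) 0 0.

Definition qform (M : 'M[R]_n) (v : 'cV[R]_n) : R := (v^T *m M *m v) 0 0.

Definition psdmx (M : 'M[R]_n) : Prop := forall v : 'cV[R]_n, 0 <= qform M v.

Definition negdefmx (M : 'M[R]_n) : Prop :=
  forall v : 'cV[R]_n, v != 0 -> qform M v < 0.

Definition ev (i : 'I_n) : 'cV[R]_n := delta_mx i 0.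

Definition pderiv (h : 'cV[R]_n -> R) (i : 'I_n) (x : 'cV[R]_n) : R :=
  'D_(ev i) h x.

Definition grad (h : 'cV[R]_n -> R) (x : 'cV[R]_n) : 'cV[R]_n :=
  \col_i pderiv h i x.

Definition hessian (h : 'cV[R]_n -> R) (x : 'cV[R]_n) : 'M[R]_n :=
  \matrix_(i, j) pderiv (pderiv h i) j x.

Definition strictly_convex (h : 'cV[R]_n -> R) : Prop :=
  forall (x y : 'cV[R]_n) (t : R), x != y -> 0 < t -> t < 1 ->
    h (t *: x + (1 - t) *: y) < t * h x + (1 - t) * h y.

Definition C2 (h : 'cV[R]_n -> R) : Prop :=
  continuous h /\
  (forall i x, derivable h x (ev i)) /\
  (forall i, continuous (pderiv h i)) /\
  (forall i j x, derivable (pderiv h i) x (ev j)) /\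
  (forall i j, continuous (pderiv (pderiv h i) j)).

Definition critical_point (h : 'cV[R]_n -> R) (x : 'cV[R]_n) : Prop :=
  differentiable h x /\ grad h x = 0.

Definition is_ginv (ginv : 'M[R]_n -> 'M[R]_n) : Prop :=
  forall M : 'M[R]_n, M *m ginv M *m M = M.

Variables (A : 'M[R]_n) (f : 'cV[R]_n)
          (B : 'I_n -> 'M[R]_n) (b : 'I_n -> 'cV[R]_n)
          (V : 'cV[R]_n -> R) (ginv : 'M[R]_n -> 'M[R]_n).

Definition Lam (x : 'cV[R]_n) : 'cV[R]_n :=
  \col_k (2^-1 * qform (B k) x + dotv (b k) x).

Definition Pi (x : 'cV[R]_n) : R :=
  V (Lam x) + 2^-1 * qform A x - dotv x f.

Definition Va : set 'cV[R]_n := range Lam.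
Definition Vastar : set 'cV[R]_n := (grad V) @` Va.

(* Legendre conjugate V^* on V_a^*: V^*(s) = <xi, s> - V(xi) where
   xi in V_a with grad V xi = s (unique since V is strictly convex);
   the value outside V_a^* is irrelevant. *)
Definition Vstar (s : 'cV[R]_n) : R :=
  let xi := xget 0 [set xi | Va xi /\ grad V xi = s] in dotv xi s - V xi.

Definition Gm (s : 'cV[R]_n) : 'M[R]_n := A + \sum_(k < n) s k 0 *: B k.
Definition Fv (s : 'cV[R]_n) : 'cV[R]_n := f - \sum_(k < n) s k 0 *: b k.

Definition Sa : set 'cV[R]_n :=
  [set s | Vastar s /\ exists y : 'cV[R]_n, Gm s *m y = Fv s].
Definition Sa_plus : set 'cV[R]_n := [set s | Sa s /\ psdmx (Gm s)].
Definition Sa_minus : set 'cV[R]_n := [set s | Sa s /\ negdefmx (Gm s)].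

Definition Pid (s : 'cV[R]_n) : R :=
  - 2^-1 * dotv (ginv (Gm s) *m Fv s) (Fv s) - Vstar s.

Definition xof (s : 'cV[R]_n) : 'cV[R]_n := ginv (Gm s) *m Fv s.

End Defs.

(* Main.v *)
Require Import Defs.
From HB Require Import structures.
From mathcomp Require Import all_boot all_order all_algebra.
From mathcomp Require Import all_classical all_reals all_analysis.
From mathcomp Require Import ring lra.
Import Order.TTheory GRing.Theory Num.Theory.
Import numFieldNormedType.Exports.
Local Open Scope classical_set_scope.
Local Open Scope ring_scope.

(** Let [Xi x s = <Lam x, s> - V^* s + x^T A x / 2 - f^T x], so that [Pi x] is the
    supremum of [Xi x] over [s], and [Pid s] is the stationary value of [Xi] in [x].
    As soon as [grad V (Lam xbar) = sbar], both parts follow from exchanging extrema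
    of [Xi]: when [Gm sbar] is positive semidefinite, both sides of (i) hold; when it
    is negative definite, [Pi] and [Pid] are both partial suprema of [Xi] near
    [(xbar, sbar)], which gives the double-max alternative of (ii).

    The identity [grad V (Lam xbar) = sbar] is the envelope theorem when [Gm sbar] is
    invertible. If [Gm sbar] is singular and positive semidefinite, the existence and
    differentiability of [Pid] around [sbar] imply that for every direction [v] the
    quadratic [v . Lam], restricted to the solutions of [Gm sbar *m x = Fv sbar], has
    a critical point with value [v . xi], where [xi] is the point with
    [grad V xi = sbar]. A linear family of quadratics with this property has a
    common point [x] where [Lam x = xi] and a common degenerate direction there; this
    is a singular critical point of [Pi], which was excluded. *)

Set Implicit Arguments. Unset Strict Implicit. Unset Printing Implicit Defensive.

(** * Euclidean product, symmetric matrices and semidefinite forms *)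

Section DotProduct.
Variables (R : realType) (n : nat).
Implicit Types (u v w : 'cV[R]_n) (M : 'M[R]_n).

Lemma dotvE u v : dotv u v = \sum_i u i 0 * v i 0.
Proof. by rewrite /dotv mxE; apply: eq_bigr => i _; rewrite mxE. Qed.

Lemma dotvC u v : dotv u v = dotv v u.
Proof. by rewrite !dotvE; apply: eq_bigr => i _; rewrite mulrC. Qed.

Lemma dotvDl u v w : dotv (u + v) w = dotv u w + dotv v w.
Proof. by rewrite !dotvE -big_split; apply: eq_bigr => i _; rewrite mxE mulrDl. Qed.

Lemma dotvDr u v w : dotv u (v + w) = dotv u v + dotv u w.
Proof. by rewrite dotvC dotvDl !(dotvC u). Qed.

Lemma dotvZl (a : R) u v : dotv (a *: u) v = a * dotv u v.
Proof. by rewrite !dotvE mulr_sumr; apply: eq_bigr => i _; rewrite mxE mulrA. Qed.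

Lemma dotvZr (a : R) u v : dotv u (a *: v) = a * dotv u v.
Proof. by rewrite dotvC dotvZl dotvC. Qed.

Lemma dotvNl u v : dotv (- u) v = - dotv u v.
Proof. by rewrite -scaleN1r dotvZl mulN1r. Qed.

Lemma dotvNr u v : dotv u (- v) = - dotv u v.
Proof. by rewrite dotvC dotvNl dotvC. Qed.

Lemma dotv0l u : dotv 0 u = 0.
Proof. by rewrite -(scale0r 0) dotvZl mul0r. Qed.

Lemma dotv0r u : dotv u 0 = 0.
Proof. by rewrite dotvC dotv0l. Qed.

Lemma dotv_suml (I : finType) (F : I -> 'cV[R]_n) u :
  dotv (\sum_i F i) u = \sum_i dotv (F i) u.
Proof.
by elim/big_rec2: _ => [|i x y _ <-]; rewrite ?dotv0l ?dotvDl.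
Qed.

Lemma dotv_mulmx M u v : dotv (M *m u) v = dotv u (M^T *m v).
Proof. by rewrite /dotv trmx_mul mulmxA. Qed.

Lemma dotv_sym M u v : M^T = M -> dotv u (M *m v) = dotv v (M *m u).
Proof. by move=> sM; rewrite dotvC dotv_mulmx sM. Qed.

Lemma qformE M v : qform M v = dotv v (M *m v).
Proof. by rewrite /qform /dotv mulmxA. Qed.

Lemma dotv_eq0 u : (forall v, dotv u v = 0) -> u = 0.
Proof.
move=> u0; apply/colP => i; rewrite mxE -[RHS](u0 (delta_mx i 0)) dotvE.
rewrite (bigD1 i)//= big1 => [|j /negbTE ji]; rewrite !mxE ?ji ?mulr0//.
by rewrite !eqxx mulr1 addr0.
Qed.

Lemma dotv_ev u i : dotv u (ev R i) = u i 0.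
Proof.
rewrite dotvE (bigD1 i)//= big1 => [|j /negbTE ji]; rewrite !mxE ?ji ?mulr0//.
by rewrite !eqxx mulr1 addr0.
Qed.

(** Fredholm alternative. The columns of [cokermx M] lie in the kernel of [M]; testing [c] against
    them puts [c^T] in the row space of [M], which symmetry turns into the column space. *)
Lemma symmetric_solvable M (c : 'cV[R]_n) : M^T = M ->
  (forall v, M *m v = 0 -> dotv v c = 0) -> exists y, M *m y = c.
Proof.
move=> sM cM; have: (c^T <= M)%MS.
  rewrite submxE; apply/eqP/rowP => j; rewrite [RHS]mxE.
  have := cM (col j (cokermx M)); rewrite colE mulmxA mulmx_coker mul0mx.
  move=> /(_ erefl); rewrite dotvC dotvE -colE => <-.
  by rewrite mxE; apply: eq_bigr => i _; rewrite !mxE.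
by case/submxP => D /(congr1 trmx); rewrite trmxK trmx_mul sM; exists D^T.
Qed.

(** The polynomial [t |-> qform M (u + t *: v)] is nonnegative. *)
Lemma psd_CauchySchwarz M u v : M^T = M -> psdmx M ->
  dotv u (M *m v) ^+ 2 <= qform M u * qform M v.
Proof.
move=> sM pM; set a := qform M u; set d := qform M v; set b := dotv _ _.
have Q t : 0 <= a + 2 * b * t + d * t ^+ 2.
  have := pM (u + t *: v); rewrite qformE mulmxDr -scalemxAr.
  rewrite !(dotvDl, dotvDr, dotvZl, dotvZr) -!qformE -/a -/d -/b.
  rewrite (dotv_sym _ _ sM) -/b; lra.
have a0 : 0 <= a by exact: pM.
have [d0|d0] := eqVneq d 0.
  have [->|b0] := eqVneq b 0; first by rewrite d0; lra.
  (* The polynomial is affine here, and this [t] would give it the value [-1]. *)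
  have := Q (- (a + 1) / (2 * b)); rewrite d0.
  suff -> : 2 * b * (- (a + 1) / (2 * b)) = - (a + 1) by lra.
  by field.
have dp : 0 < d by rewrite lt_neqAle eq_sym d0; exact: pM.
have := Q (- b / d).
have -> : a + 2 * b * (- b / d) + d * (- b / d) ^+ 2 = (a * d - b ^+ 2) / d.
  by field.
by rewrite pmulr_lge0 ?invr_gt0// subr_ge0.
Qed.

End DotProduct.

(** * Linear dependence, determinants and ranks of matrix pencils *)

Lemma symmetricmx_tr (R : realType) n (M : 'M[R]_n) :
  M \is symmetricmx -> M^T = M.
Proof.
move=> /is_hermitianmxP; rewrite expr0 scale1r => {2}->.
by apply/matrixP => i j; rewrite !mxE.
Qed.

(* More than [n] vectors are linearly dependent; if all their mutual products are
   small, the coefficient of largest modulus forces one of the squares to be small. *)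
Lemma small_square_of_small_products (R : realType) n (M : 'M[R]_n)
    (w : 'I_n.+1 -> 'cV[R]_n) (T : R) :
  (forall i j, i != j -> `|dotv (w i) (M *m w j)| <= T) ->
  exists i, qform M (w i) <= n%:R * T.
Proof.
move=> wT; pose W := \matrix_(i < n.+1, j < n) w i j 0.
have : kermx W != 0.
  rewrite kermx_eq0 /row_free neq_ltn.
  by rewrite (leq_ltn_trans (rank_leq_col W))// ltnSn.
case/rowV0Pn => l /sub_kermxP lW l0.
have [i imax] : exists i, forall j, `|l 0 j| <= `|l 0 i|.
  have [i _ hi] := @arg_maxP _ _ _ (ord0 : 'I_n.+1) xpredT (fun j => `|l 0 j|) isT.
  by exists i => j; apply: hi.
have li0 : 0 < `|l 0 i|.
  rewrite normr_gt0; apply: contraNneq l0 => li; apply/eqP/rowP => j.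
  by rewrite mxE; apply/eqP; rewrite -normr_le0 (le_trans (imax j))// li normr0.
exists i.
have sum0 : \sum_j l 0 j * dotv (w i) (M *m w j) = 0.
  have -> : \sum_j l 0 j * dotv (w i) (M *m w j)
          = dotv (\sum_j l 0 j *: w j) (M^T *m w i).
    rewrite dotv_suml; apply: eq_bigr => j _.
    by rewrite dotvZl -dotv_mulmx dotvC.
  suff -> : \sum_j l 0 j *: w j = 0 by rewrite dotv0l.
  apply/colP => k; rewrite summxE mxE.
  move/rowP: lW => /(_ k); rewrite !mxE => lWk.
  by rewrite -[RHS]lWk; apply: eq_bigr => j _; rewrite !mxE.
rewrite qformE -(ler_pM2l li0).
move: sum0; rewrite (bigD1 i)//= => /eqP; rewrite addr_eq0 => /eqP sum0.
apply: (@le_trans _ _ `|l 0 i * dotv (w i) (M *m w i)|).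
  by rewrite normrM ler_wpM2l// ler_norm.
rewrite sum0 normrN (le_trans (ler_norm_sum _ _ _))//.
apply: (@le_trans _ _ (\sum_(j < n.+1 | j != i) `|l 0 i| * T)).
  apply: ler_sum => j ji; rewrite normrM ler_pM ?wT// eq_sym//.
rewrite sumr_const cardC1 card_ord /= -mulr_natl mulrCA; lra.
Qed.

(** The determinant is a polynomial in [t] with infinitely many roots, so it also vanishes at [0];
    this replaces a passage to the limit. *)
Lemma det_pencil_eq0 (R : numFieldType) k (M N : 'M[R]_k) :
  (forall t : R, t != 0 -> \det (M + t *: N) = 0) -> \det M = 0.
Proof.
move=> MN0; pose p := \det (map_mx polyC M + 'X *: map_mx polyC N).
have pE t : p.[t] = \det (M + t *: N).
  rewrite -[p.[t]]/(horner_eval t p) /p -det_map_mx; congr (\det _).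
  by apply/matrixP => i j; rewrite !mxE /= /horner_eval !hornerE.
suff p0 : p = 0 by have := pE 0; rewrite p0 horner0 scale0r addr0.
apply/eqP; apply: contraT => p0.
(* There are [size p] distinct roots, one more than the degree allows. *)
have := @max_poly_roots _ p [seq i.+1%:R | i <- iota 0 (size p)] p0.
rewrite size_map size_iota ltnn; apply.
  by apply/allP => _ /mapP [i _ ->]; rewrite /root pE MN0// pnatr_eq0.
rewrite map_inj_uniq ?iota_uniq// => i j /eqP; rewrite eqr_nat => /eqP [].
exact.
Qed.

(* Bordering the maximal minor [X *m Q *m Y = 1] of [Q] by the kernel vectors [u]
   and [v] gives a minor of [Q + t *: E] that vanishes for every [t]. *)
Lemma maxrank_pencil (R : numFieldType) m (Q : 'M[R]_m) :
  exists Y : 'M[R]_m, Q *m Y *m Q = Q /\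
    forall (E : 'M[R]_m) (u : 'rV[R]_m) (v : 'cV[R]_m),
      (forall t : R, (\rank (Q + t *: E)%R <= \rank Q)%N) ->
      u *m Q = 0 -> Q *m v = 0 ->
      u *m E *m v = 0 /\ u *m E *m Y *m E *m v = 0.
Proof.
(* One-sided inverses of the two factors of the rank factorization of [Q]; their product [Z *m X] is
   a generalized inverse of [Q]. *)
pose X := pinvmx (col_base Q); pose Z := pinvmx (row_base Q).
have XC : X *m col_base Q = 1%:M by rewrite mulVpmx// col_base_full.
have RZ : row_base Q *m Z = 1%:M by rewrite mulmxVp// row_base_free.
have XQZ : X *m Q *m Z = 1%:M.
  have : X *m (col_base Q *m row_base Q) *m Z = 1%:M by rewrite mulmxA XC mul1mx.
  by rewrite mulmx_base.
exists (Z *m X); split.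
  have : (col_base Q *m row_base Q) *m (Z *m X) *m (col_base Q *m row_base Q)
      = col_base Q *m row_base Q.
    rewrite -(mulmxA (col_base Q)) (mulmxA (row_base Q)) RZ mul1mx.
    by rewrite -(mulmxA (col_base Q) X) (mulmxA X) XC mul1mx.
  by rewrite mulmx_base.
move=> E u v rk uQ Qv.
pose N := X *m E *m Z; pose a := X *m E *m v; pose b := u *m E *m Z.
pose c := u *m E *m v.
have border t :
    \det (block_mx (1%:M + t *: N) (t *: a) (t *: b) (t *: c)) = 0.
  have -> : block_mx (1%:M + t *: N) (t *: a) (t *: b) (t *: c)
      = col_mx X u *m (Q + t *: E) *m row_mx Z v.
    rewrite mul_col_mx mul_col_row !mulmxDr !mulmxDl uQ -!scalemxAr -!scalemxAl.
    by rewrite XQZ -!(mulmxA _ Q v) Qv mulmx0 !mul0mx !add0r.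
  (* A nonzero determinant would mean rank [\rank Q + 1], but the middle factor [Q + t *: E] has
     rank at most [\rank Q]. *)
  apply/eqP; rewrite -[_ == 0]negbK; apply/negP.
  rewrite -unitfE -unitmxE -row_free_unit /row_free => /eqP rk1.
  have : (\rank (col_mx X u *m (Q + t *: E)%R *m row_mx Z v)
          <= \rank Q)%N.
    apply: (leq_trans (mxrankM_maxl _ _)).
    exact: (leq_trans (mxrankM_maxr _ _)).
  by rewrite rk1 addn1 ltnn.
have detS t (A1 : 'M[R]_(\rank Q)) a1 (b1 : 'rV[R]_(\rank Q)) (c1 : 'M[R]_1) :
    \det (block_mx A1 a1 (t *: b1) (t *: c1)) = t * \det (block_mx A1 a1 b1 c1).
  have -> : block_mx A1 a1 (t *: b1) (t *: c1)
      = block_mx 1%:M 0 0 t%:M *m block_mx A1 a1 b1 c1.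
    by rewrite mulmx_block !mul1mx !mul0mx !addr0 !add0r !mul_scalar_mx.
  by rewrite det_mulmx det_lblock det1 mul1r det_scalar1.
have detSr t (A1 : 'M[R]_(\rank Q)) a1 (b1 : 'rV[R]_(\rank Q)) (c1 : 'M[R]_1) :
    \det (block_mx A1 (t *: a1) b1 (t *: c1)) = t * \det (block_mx A1 a1 b1 c1).
  have -> : block_mx A1 (t *: a1) b1 (t *: c1)
      = block_mx A1 a1 b1 c1 *m block_mx 1%:M 0 0 t%:M.
    by rewrite mulmx_block !mulmx1 !mulmx0 !addr0 !add0r !mul_mx_scalar.
  by rewrite det_mulmx det_lblock det1 mul1r det_scalar1 mulrC.
(* The factor [t] of the last row is divided out before setting [t] to [0]. *)
have c0 : c = 0.
  have : \det (block_mx (1%:M : 'M[R]_(\rank Q)) 0 b c) = 0.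
    apply: (@det_pencil_eq0 _ _ _ (block_mx N a 0 0)) => t t0.
    rewrite scale_block_mx add_block_mx !scaler0 add0r !addr0.
    by apply/(mulfI t0); rewrite -detS mulr0 border.
  rewrite det_lblock det1 mul1r => c0.
  by rewrite [c]mx11_scalar -det_mx11 c0 raddf0.
split=> //.
(* With [c = 0], a second factor [t] comes out of the last column; at [t = 0] the remaining
   determinant is that of [- (b *m a)]. *)
have : \det (block_mx (1%:M : 'M[R]_(\rank Q)) a b 0) = 0.
  apply: (@det_pencil_eq0 _ _ _ (block_mx N 0 0 0)) => t t0.
  rewrite scale_block_mx add_block_mx !scaler0 !addr0.
  have := border t; rewrite c0 scaler0 -(scaler0 _ t) detS => /eqP.
  rewrite mulf_eq0 (negbTE t0) /= => /eqP bd.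
  by apply: (mulfI t0); rewrite mulr0 -detSr !scaler0.
have -> : block_mx (1%:M : 'M[R]_(\rank Q)) a b 0
    = block_mx 1%:M 0 b 1%:M *m block_mx 1%:M a 0 (- (b *m a)).
  by rewrite mulmx_block !mul1mx !mul0mx mulmx1 !addr0 subrr.
rewrite det_mulmx det_lblock det_ublock !det1 !mul1r => /eqP.
rewrite det_mx11 mxE oppr_eq0 => /eqP ba.
have -> : u *m E *m (Z *m X) *m E *m v = b *m a by rewrite /a /b !mulmxA.
by rewrite [b *m a]mx11_scalar ba raddf0.
Qed.

(** * Solutions of [(G + t H) y = F - t beta] as [t] decreases to 0 *)

Section Pencil.
Variables (R : realType) (n : nat) (G H : 'M[R]_n) (F beta : 'cV[R]_n).
Hypotheses (sG : G^T = G) (sH : H^T = H).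

Lemma pencil_diff (x y : 'cV[R]_n) (t : R) : G *m x = F ->
  (G + t *: H) *m y = F - t *: beta ->
  (G + t *: H) *m (y - x) = - t *: (H *m x + beta).
Proof.
move=> Gx Gy; rewrite mulmxBr Gy mulmxDl Gx -scalemxAl opprD addrACA subrr.
by rewrite add0r -opprD -scalerDr scaleNr addrC [_ + beta]addrC.
Qed.

(** The expansion is exact, with the product of [y - x] and [H *m x + beta] as its only remainder.
    Differentiability of the value in [t] therefore controls this product without any bound on
    [y - x]. *)
Lemma pencil_value (x y : 'cV[R]_n) (t : R) : G *m x = F ->
  (G + t *: H) *m y = F - t *: beta ->
  2^-1 * qform (G + t *: H) y - dotv y (F - t *: beta)
  = (2^-1 * qform G x - dotv x F) + t * (2^-1 * qform H x + dotv beta x)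
    + t / 2 * dotv (y - x) (H *m x + beta).
Proof.
move=> Gx Gy; have := congr1 (dotv x) (pencil_diff Gx Gy).
rewrite !qformE Gy; move: (y - x) (subrK x y) => w <-.
rewrite -Gx mulmxDl -scalemxAl !(dotvDl, dotvDr, dotvZl, dotvZr, dotvNr, dotvNl).
rewrite (dotv_sym x w sG) (dotv_sym x w sH) (dotvC beta x); lra.
Qed.

(* With [c = H *m x + beta], the vectors [w t = y t - x] satisfy
   [G w / t + H w = - c], whence the Loewner-type identity
   [(1/t - 1/s) <w s, G w t> = <w t, c> - <w s, c>]. *)
Lemma pencil_products (x ys yt : 'cV[R]_n) (s t : R) : G *m x = F ->
  s != 0 -> t != 0 ->
  (G + s *: H) *m ys = F - s *: beta ->
  (G + t *: H) *m yt = F - t *: beta ->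
  (t^-1 - s^-1) * dotv (ys - x) (G *m (yt - x)) =
  dotv (yt - x) (H *m x + beta) - dotv (ys - x) (H *m x + beta).
Proof.
move=> Gx s0 t0 /(pencil_diff Gx) Hs /(pencil_diff Gx) Ht.
have := congr1 (dotv (yt - x)) Hs; have := congr1 (dotv (ys - x)) Ht.
move: (ys - x) (yt - x) (H *m x + beta) => u v w {Hs Ht}.
rewrite !mulmxDl -!scalemxAl !dotvDr !dotvZr.
rewrite (dotv_sym v u sG) (dotv_sym v u sH).
move: (dotv u (G *m v)) (dotv u (H *m v)) (dotv u w) (dotv v w) => a b c d e1 e2.
have -> : c = - (t^-1 * a + b).
  by apply: (mulfI t0); rewrite mulrN mulrDr mulVKf//; lra.
have -> : d = - (s^-1 * a + b).
  by apply: (mulfI s0); rewrite mulrN mulrDr mulVKf//; lra.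
lra.
Qed.

Variables (y : R -> 'cV[R]_n) (d : R).
Hypotheses (pG : psdmx G) (d0 : 0 < d)
  (Hy : forall t, 0 < t < d -> (G + t *: H) *m y t = F - t *: beta).

(** By [pencil_products], convergence of the product with [H *m x + beta] makes the mutual
    [G]-products of the vectors [y t - x] small at well separated values of [1/t];
    [small_square_of_small_products] then yields one small square. *)
Lemma pencil_small_energy (x : 'cV[R]_n) (l : R) : G *m x = F ->
  (forall e, 0 < e -> exists2 d', 0 < d' & forall t, 0 < t < d' ->
     `|dotv (y t - x) (H *m x + beta) - l| <= e) ->
  forall e d', 0 < e -> 0 < d' ->
  exists2 t, 0 < t < d' & qform G (y t - x) <= e.
Proof.
move=> Gx lim e d' e0 d'0; have [d1 d10 Hd1] := lim 2^-1 ltac:(lra).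
pose T := Num.min (Num.min (d' / 2) (d / 2)) (Num.min (d1 / 2) (e / n.+1%:R)).
have T0 : 0 < T by rewrite !lt_min !divr_gt0//= ?ltr0n.
have Td' : T < d' by rewrite /T !gt_min; apply/orP; left; apply/orP; left; lra.
have Td : T < d.
  by rewrite /T !gt_min; apply/orP; left; apply/orP; right; have := d0; lra.
have Td1 : T < d1 by rewrite /T !gt_min; apply/orP; right; apply/orP; left; lra.
have Te : T <= e / n.+1%:R.
  by rewrite /T !ge_min; apply/orP; right; apply/orP; right; exact: lexx.
(* The reciprocals [(i + 1) / T] differ pairwise by at least [1 / T], so every mutual product is at
   most [T]. *)
pose tt (i : 'I_n.+1) := T / i.+1%:R.
have tt0 i : 0 < tt i by rewrite divr_gt0// ltr0n.
have ttT i : tt i <= T.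
  by rewrite ler_pdivrMr ?ltr0n// ler_peMr ?ler1n// ltW.
have [i j ij|i wi] := @small_square_of_small_products R n G
    (fun i => y (tt i) - x) T.
  have Hij k : (G + tt k *: H) *m y (tt k) = F - tt k *: beta.
    by apply: Hy; rewrite tt0 (le_lt_trans (ttT k)).
  have := pencil_products Gx (lt0r_neq0 (tt0 i)) (lt0r_neq0 (tt0 j)) (Hij i) (Hij j).
  move: (dotv (_ - _) (G *m _)) => g gE.
  have g1 : `|((tt j)^-1 - (tt i)^-1) * g| <= 1.
    have lt1 k : 0 < tt k < d1 by rewrite tt0 (le_lt_trans (ttT k)).
    rewrite gE; move: (Hd1 _ (lt1 j)) (Hd1 _ (lt1 i)).
    set p := dotv (y (tt j) - x) _; set q := dotv (y (tt i) - x) _ => Hp Hq.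
    rewrite (_ : p - q = (p - l) - (q - l)); last by ring.
    by rewrite (le_trans (ler_normB _ _))//; lra.
  have tij : T^-1 <= `|(tt j)^-1 - (tt i)^-1|.
    rewrite /tt !invf_div -mulrBl normrM (gtr0_norm (x := T^-1)) ?invr_gt0//.
    rewrite ler_peMl ?invr_ge0 ?(ltW T0)//.
    have : i != j :> nat by [].
    rewrite neq_ltn => /orP [] lt.
      by rewrite -natrB ?ltnS ?(ltnW lt)// normr_nat ler1n subn_gt0 ltnS.
    by rewrite distrC -natrB ?ltnS ?(ltnW lt)// normr_nat ler1n subn_gt0 ltnS.
  rewrite -(ler_pM2l (x := T^-1)) ?invr_gt0// mulVf ?gt_eqF//.
  apply: le_trans g1; rewrite normrM ler_wpM2r//.
exists (tt i); first by rewrite tt0 (le_lt_trans (ttT i)).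
apply: (le_trans wi); apply: (@le_trans _ _ (n.+1%:R * T)).
  by rewrite ler_wpM2r ?(ltW T0)// ler_nat.
by move: Te; rewrite ler_pdivlMr ?ltr0n// mulrC.
Qed.

(* Cauchy-Schwarz for the semi-inner product of [G], along parameters at which
   the energy of [y t - x] is small. *)
Lemma pencil_energy_zero (x eta : 'cV[R]_n) (l a : R) : G *m x = F ->
  (forall e, 0 < e -> exists2 d', 0 < d' & forall t, 0 < t < d' ->
     `|dotv (y t - x) (H *m x + beta) - l| <= e) ->
  (forall e, 0 < e -> exists2 d', 0 < d' & forall t, 0 < t < d' ->
     `|dotv eta (G *m (y t - x)) - a| <= e) ->
  a = 0.
Proof.
move=> Gx lim lima; apply/eqP; rewrite -normr_le0 leNgt; apply/negP => a0.
have [d1 d10 Hd1] := lima (`|a| / 2) ltac:(lra).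
pose k := qform G eta + 1; have k0 : 0 < k by have := pG eta; rewrite /k; lra.
(* At this energy Cauchy-Schwarz gives [g ^+ 2 <= a ^+ 2 / 8], while [g] is within [|a| / 2] of
   [a]. *)
have ek : 0 < `|a| ^+ 2 / (8 * k).
  by rewrite divr_gt0 ?exprn_gt0 ?mulr_gt0.
have [t td1 wt] := pencil_small_energy Gx lim ek d10.
have := psd_CauchySchwarz eta (y t - x) sG pG.
have := Hd1 _ td1; move: (dotv eta _) => g ga gE.
have ag : `|a| / 2 <= `|g|.
  have : `|a| <= `|g| + `|g - a|.
    by rewrite (_ : `|a| = `|g - (g - a)|) ?ler_normB//; congr (`|_|); ring.
  lra.
have : qform G eta * qform G (y t - x) <= k * (`|a| ^+ 2 / (8 * k)).
  by apply: ler_pM; [exact: pG | exact: pG | rewrite /k; lra | exact: wt].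
have -> : k * (`|a| ^+ 2 / (8 * k)) = `|a| ^+ 2 / 8 by field; rewrite gt_eqF.
have : (`|a| / 2) ^+ 2 <= g ^+ 2.
  rewrite -(real_normK (num_real g)) lerXn2r ?nnegrE//; lra.
have : 0 < `|a| ^+ 2 by rewrite exprn_gt0.
rewrite expr_div_n; lra.
Qed.

(** A derivative [l] of the stationary value at [t = 0] forces the quadratic with data [H], [beta]
    to have a critical point of value [l] on the solution set of [G *m x = F]; [eta] is the Lagrange
    multiplier. *)
Lemma pencil_limit_solution (x0 : 'cV[R]_n) (l : R) : G *m x0 = F ->
  (forall e, 0 < e -> exists2 d', 0 < d' & forall t, 0 < t < d' ->
     `|(2^-1 * qform (G + t *: H) (y t) - dotv (y t) (F - t *: beta))
       - (2^-1 * qform G x0 - dotv x0 F) - t * l| <= e * t) ->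
  exists x eta, [/\ G *m x = F, H *m x + beta = - (G *m eta) &
    2^-1 * qform H x + dotv beta x = l].
Proof.
move=> Gx0 val.
have lim x : G *m x = F -> forall e, 0 < e ->
    exists2 d', 0 < d' & forall t, 0 < t < d' ->
     `|dotv (y t - x) (H *m x + beta)
       - 2 * (l - (2^-1 * qform H x + dotv beta x))| <= e.
  move=> Gx e e0; have [d1 d10 Hd1] := val (e / 2) ltac:(lra).
  exists (Num.min d d1); first by rewrite lt_min d0.
  move=> t /andP [t0]; rewrite lt_min => /andP [td td1].
  have := Hd1 t; rewrite t0 td1 => /(_ isT).
  have tdd : 0 < t < d by rewrite t0.
  rewrite (pencil_value Gx (Hy tdd)).
  have -> : 2^-1 * qform G x0 - dotv x0 F = 2^-1 * qform G x - dotv x F.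
    have : dotv x0 F = dotv x F by rewrite -{1}Gx (dotv_sym _ _ sG) Gx0.
    by rewrite !qformE Gx0 Gx => ->.
  move: (dotv (y t - x) _) (2^-1 * qform H x + _) (2^-1 * qform G x - _) => p q r.
  rewrite (_ : _ - r - t * l = t * (2^-1 * (p - 2 * (l - q)))); last by field.
  rewrite normrM (gtr0_norm t0) (mulrC t) ler_pM2r// normrM.
  by rewrite gtr0_norm ?invr_gt0//; lra.
(* For a kernel vector of the Lagrange system, the obstruction to solvability equals a product with
   [G *m (y t - x0)], and it does not depend on [t]. *)
have tc (z z' : 'cV[R]_n) (t : R) : G *m z = 0 -> H *m z + G *m z' = 0 ->
    0 < t < d -> dotv z' (G *m (y t - x0)) = dotv z (H *m x0 + beta).
  move=> Gz Hz td; have t0 : t != 0 by move: td => /andP [/lt0r_neq0].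
  have := congr1 (dotv z) (pencil_diff Gx0 (Hy td)).
  rewrite mulmxDl -scalemxAl dotvDr !dotvZr (dotv_sym z _ sG) Gz dotv0r add0r.
  rewrite (dotv_sym z _ sH) mulNr -mulrN => /(mulfI t0).
  have -> : H *m z = - (G *m z') by apply/eqP; rewrite -addr_eq0 Hz.
  by rewrite dotvNr => /oppr_inj <-; exact: dotv_sym.
(* The Lagrange system for a correction [k] of [x0] and a multiplier; [pencil_energy_zero] removes
   the Fredholm obstruction. *)
have [v Hv] : exists v, block_mx H G G 0 *m v = col_mx (- (H *m x0 + beta)) 0.
  apply: symmetric_solvable; first by rewrite tr_block_mx sG sH trmx0.
  move=> v; rewrite -(vsubmxK v); move: (usubmx v) (dsubmx v) => z z'.
  rewrite mul_block_col mul0mx addr0 => /eqP; rewrite col_mx_eq0.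
  move=> /andP [/eqP Hz /eqP Gz].
  rewrite /dotv tr_col_mx mul_row_col mulmx0 addr0 -/(dotv _ _) dotvNr.
  apply/eqP; rewrite oppr_eq0; apply/eqP.
  apply: (@pencil_energy_zero x0 z' _ _ Gx0 (lim x0 Gx0)) => e e0.
  by exists d => // t td; rewrite (tc z)// subrr normr0 ltW.
move: Hv; rewrite -(vsubmxK v); move: (usubmx v) (dsubmx v) => k eta.
rewrite mul_block_col mul0mx addr0 => /eq_col_mx [Hk Gk].
have Gx : G *m (x0 + k) = F by rewrite mulmxDr Gk addr0.
have Hx : H *m (x0 + k) + beta = - (G *m eta).
  have -> : H *m (x0 + k) = H *m x0 + (- (H *m x0 + beta) - G *m eta).
    by rewrite mulmxDr -Hk addrK.
  by rewrite addrAC addrA subrr add0r.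
exists (x0 + k), eta; split => //.
(* At the critical point [H *m x + beta] lies in the range of [G], so the limit given by [lim] is
   again an energy product and vanishes. *)
suff : 2 * (l - (2^-1 * qform H (x0 + k) + dotv beta (x0 + k))) = 0 by lra.
apply: (@pencil_energy_zero (x0 + k) (- eta) _ _ Gx (lim _ Gx)) => e e0.
have [d1 d10 Hd1] := lim _ Gx e e0; exists d1 => // t /Hd1.
by rewrite Hx dotvNr dotvNl (dotv_sym _ _ sG).
Qed.

End Pencil.

(** * The linear family of quadratics [s . Lam] and its common degenerate zeros *)

Section LinearFamily.
Variables (R : realType) (n : nat) (B : 'I_n -> 'M[R]_n) (b : 'I_n -> 'cV[R]_n).

Definition linmx (s : 'cV[R]_n) : 'M[R]_n := \sum_(k < n) s k 0 *: B k.
Definition lincv (s : 'cV[R]_n) : 'cV[R]_n := \sum_(k < n) s k 0 *: b k.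

Lemma linmxDZ s t tau : linmx (s + t *: tau) = linmx s + t *: linmx tau.
Proof.
rewrite /linmx scaler_sumr -big_split; apply: eq_bigr => k _ /=.
by rewrite !mxE scalerDl scalerA.
Qed.

Lemma lincvDZ s t tau : lincv (s + t *: tau) = lincv s + t *: lincv tau.
Proof.
rewrite /lincv scaler_sumr -big_split; apply: eq_bigr => k _ /=.
by rewrite !mxE scalerDl scalerA.
Qed.

Lemma linmx_sym s : (forall k, (B k)^T = B k) -> (linmx s)^T = linmx s.
Proof.
move=> sB; rewrite /linmx linear_sum; apply: eq_bigr => k _.
by rewrite linearZ /= sB.
Qed.

End LinearFamily.

Lemma dotv_col (R : realType) m n (u v : 'cV[R]_m) (u' v' : 'cV[R]_n) :
  dotv (col_mx u u') (col_mx v v') = dotv u v + dotv u' v'.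
Proof. by rewrite /dotv tr_col_mx mul_row_col mxE. Qed.

Lemma dotv1 (R : realType) (a c : R) : dotv a%:M c%:M = a * c.
Proof. by rewrite /dotv tr_scalar_mx -scalar_mxM mxE eqxx mulr1n. Qed.

(** The map [E |-> u . E Y E u] is quadratic; the conclusion is the vanishing of its polar form. *)
Lemma polarization (R : realType) m (u : 'cV[R]_m) (Y E1 E2 : 'M[R]_m) :
  E1^T = E1 -> E2^T = E2 ->
  dotv u (E1 *m Y *m E1 *m u) = 0 -> dotv u (E2 *m Y *m E2 *m u) = 0 ->
  dotv u ((E1 + E2) *m Y *m (E1 + E2) *m u) = 0 ->
  dotv (E1 *m u) (Y *m (E2 *m u)) + dotv (E2 *m u) (Y *m (E1 *m u)) = 0.
Proof.
move=> s1 s2 h1 h2; rewrite !(mulmxDl, mulmxDr) !dotvDr h1 h2 add0r addr0.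
by rewrite !dotv_mulmx s1 s2 !mulmxA addrC.
Qed.

(* The quadratics [x |-> s . (Lam x - xi)] on the solution set of [G x = F],
   homogenized with a multiplier [eta] for the constraint, form an affine pencil of
   symmetric matrices. The hypothesis says that every member has a kernel vector
   [(x, eta, 1)]; at a member of maximal rank, [maxrank_pencil] turns this vector
   into a common zero [x] of all the quadratics, together with a common degenerate
   direction [z]. *)
Lemma degenerate_common_zero (R : realType) n (G : 'M[R]_n) (F : 'cV[R]_n)
    (B : 'I_n -> 'M[R]_n) (b : 'I_n -> 'cV[R]_n) (xi k0 : 'cV[R]_n) :
  G^T = G -> (forall k, (B k)^T = B k) -> k0 != 0 -> G *m k0 = 0 ->
  (forall s, exists x eta, [/\ G *m x = F,
     linmx B s *m x + lincv b s = - (G *m eta) &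
     2^-1 * qform (linmx B s) x + dotv (lincv b s) x = dotv s xi]) ->
  exists x z, [/\ G *m x = F, z != 0, G *m z = 0,
    (forall s, 2^-1 * qform (linmx B s) x + dotv (lincv b s) x = dotv s xi) &
    (forall s, dotv z (linmx B s *m x + lincv b s) = 0)].
Proof.
move=> sG sB k00 Gk0 sol.
have sL s : (linmx B s)^T = linmx B s by exact: linmx_sym.
(* In coordinates [(x, eta, a)] the form of [E s] is twice the homogenized [s . (Lam x - xi)], and
   the form of [Q0] is twice [eta . (G x - a F)]. *)
pose E s : 'M[R]_(n + (n + 1)) := block_mx (linmx B s) (row_mx 0 (lincv b s))
  (col_mx 0 (lincv b s)^T) (block_mx 0 0 0 (- 2 * dotv s xi)%:M).
pose Q0 : 'M[R]_(n + (n + 1)) := block_mx 0 (row_mx G 0) (col_mx G 0)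
  (block_mx 0 (- F) (- F^T) 0).
have sE s : (E s)^T = E s.
  rewrite /E tr_block_mx sL tr_row_mx tr_col_mx tr_block_mx trmxK.
  by rewrite !trmx0 tr_scalar_mx.
have sQ0 : Q0^T = Q0.
  rewrite /Q0 tr_block_mx tr_row_mx tr_col_mx tr_block_mx !linearN /= trmxK sG.
  by rewrite !trmx0.
pose vec (x eta : 'cV[R]_n) (a : R) : 'cV[R]_(n + (n + 1)) :=
  col_mx x (col_mx eta a%:M).
have Evec s x eta a : E s *m vec x eta a =
    vec (linmx B s *m x + a *: lincv b s) 0
        (dotv (lincv b s) x - 2 * dotv s xi * a).
  rewrite /E /vec mul_block_col mul_row_col mul0mx add0r mul_mx_scalar.
  rewrite mul_col_mx mul_block_col !mul0mx add_col_mx !add0r.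
  congr (col_mx _ (col_mx _ _)).
  rewrite [_ *m x]mx11_scalar -/(dotv _ _) -scalar_mxM -raddfD /=.
  by congr (_%:M); ring.
have Q0vec x eta a : Q0 *m vec x eta a =
    vec (G *m eta) (G *m x - a *: F) (- dotv F eta).
  rewrite /Q0 /vec mul_block_col mul_row_col !mul0mx add0r addr0.
  rewrite mul_col_mx mul_block_col !mul0mx add_col_mx !add0r addr0.
  rewrite mulNmx mul_mx_scalar; congr (col_mx _ (col_mx _ _)).
  by rewrite mulNmx [_ *m eta]mx11_scalar -/(dotv _ _) raddfN.
have dvec x eta a x' eta' a' :
    dotv (vec x eta a) (vec x' eta' a') = dotv x x' + dotv eta eta' + a * a'.
  by rewrite !dotv_col dotv1 addrA.
have vecDZ x eta a x' eta' a' t : vec x eta a + t *: vec x' eta' a'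
    = vec (x + t *: x') (eta + t *: eta') (a + t * a').
  by rewrite /vec !scale_col_mx !add_col_mx scale_scalar_mx -raddfD.
have vecP v : exists x eta a, v = vec x eta a.
  exists (usubmx v), (usubmx (dsubmx v)), (dsubmx (dsubmx v) 0 0).
  by rewrite /vec -mx11_scalar !vsubmxK.
have EDZ s t tau : E (s + t *: tau) = E s + t *: E tau.
  suff EDZv (v : 'cV_(n + (n + 1))) : E (s + t *: tau) *m v = (E s + t *: E tau) *m v.
    apply/matrixP => i j; have /colP/(_ i) := EDZv (delta_mx j 0).
    by rewrite -!colE !mxE.
  have [x [eta [a ->]]] := vecP v.
  rewrite mulmxDl -scalemxAl !Evec vecDZ linmxDZ lincvDZ scaler0 addr0.
  rewrite mulmxDl -scalemxAl !dotvDl !dotvZl; congr (vec _ _ _); last by ring.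
  by apply/colP => i; rewrite !mxE; ring.
pose Q s := Q0 + E s.
have sQ s : (Q s)^T = Q s by rewrite /Q linearD /= sE sQ0.
have [s maxs] : exists s, forall s', (\rank (Q s') <= \rank (Q s))%N.
  pose P r := `[< exists s, \rank (Q s) = r >].
  have exP : exists r, P r by exists (\rank (Q 0)); apply/asboolP; exists 0.
  have ubP r : P r -> (r <= n + (n + 1))%N.
    by move=> /asboolP [s <-]; exact: rank_leq_row.
  case: (ex_maxnP exP ubP) => r /asboolP [s <-] max; exists s => s'.
  by apply: max; apply/asboolP; exists s'.
have [x [eta [Gx Hx vx]]] := sol s; pose u := vec x eta 1.
have Qu : Q s *m u = 0.
  rewrite /Q mulmxDl Q0vec Evec !scale1r mulr1 Gx subrr Hx.
  rewrite /vec !add_col_mx subrr addr0 -raddfD /=.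
  (* The last coordinate: pairing the stationarity equation with [x] and using the value condition,
     as in Euler's identity. *)
  rewrite (_ : _ + _ = 0) ?raddf0 ?col_mx0//.
  have := congr1 (dotv x) Hx; rewrite dotvDr dotvNr -qformE (dotv_sym _ _ sG) Gx.
  by rewrite (dotvC eta) (dotvC x) -vx; lra.
have uQ v : Q s *m v = 0 -> v^T *m Q s = 0.
  by move=> Qv; rewrite -(sQ s) -trmx_mul Qv trmx0.
have rk tau t : (\rank (Q s + t *: E tau)%R <= \rank (Q s))%N.
  by rewrite /Q -addrA -EDZ maxs.
have [Y [QYQ maxr]] := maxrank_pencil (Q s).
have iso tau v : Q s *m v = 0 -> dotv v (E tau *m u) = 0.
  move=> Qv; have [+ _] := maxr _ _ _ (rk tau) (uQ _ _ Qv) Qu.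
  by rewrite /dotv mulmxA => ->; rewrite mxE.
have EYE tau : dotv u (E tau *m Y *m E tau *m u) = 0.
  have [_] := maxr _ _ _ (rk tau) (uQ _ _ Qu) Qu.
  by rewrite /dotv !mulmxA => ->; rewrite mxE.
(* Up to sign, the first-order motion of the kernel vector [u] when the pencil moves along [tau]. *)
pose z tau := Y *m (E tau *m u).
have Qz tau : Q s *m z tau = E tau *m u.
  rewrite /z; have [w <-] := symmetric_solvable (sQ s) (iso tau).
  by rewrite (mulmxA (Q s)) mulmxA QYQ.
have zE tau rho : dotv (z tau) (E rho *m u) = 0.
  (* Polarization makes the sum of two products vanish; symmetry of [Q s] makes them equal, so each
     is zero. *)
  have pol : dotv (E tau *m u) (z rho) + dotv (E rho *m u) (z tau) = 0.
    apply: polarization => //.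
    by have := EYE (tau + 1 *: rho); rewrite EDZ scale1r.
  have : dotv (E tau *m u) (z rho) = dotv (z tau) (E rho *m u).
    by rewrite -!Qz dotvC (dotv_sym _ _ (sQ s)).
  by move: pol; rewrite (dotvC (E rho *m u)); lra.
exists x.
have zero tau : 2^-1 * qform (linmx B tau) x + dotv (lincv b tau) x = dotv tau xi.
  have := iso tau u Qu; rewrite Evec dvec dotv0r scale1r dotvDr -qformE.
  by rewrite (dotvC x (lincv _ _)); lra.
pose zx tau := usubmx (z tau).
pose ze tau := usubmx (dsubmx (z tau)); pose za tau := dsubmx (dsubmx (z tau)) 0 0.
have zV tau : z tau = vec (zx tau) (ze tau) (za tau).
  by rewrite /vec -mx11_scalar !vsubmxK.
(* Subtracting a multiple of [u] cancels the homogenizing coordinate and leaves a direction tangent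
   to the solution set. *)
pose kx tau := zx tau - za tau *: x.
have Gkx tau : G *m kx tau = 0 /\
    linmx B s *m kx tau + G *m (ze tau - za tau *: eta)
    = linmx B tau *m x + lincv b tau.
  have := Qz tau; rewrite zV /Q mulmxDl Q0vec !Evec scale1r /vec !add_col_mx.
  move=> /eq_col_mx [e1 /eq_col_mx [e2 _]]; split.
    by rewrite /kx mulmxBr -scalemxAr Gx -[RHS]e2 addr0.
  rewrite -e1 /kx !mulmxBr -!scalemxAr -(opprK (G *m eta)) -Hx.
  by apply/colP => i; rewrite !mxE; ring.
have dkx tau rho : dotv (kx tau) (linmx B rho *m x + lincv b rho) = 0.
  have := zE tau rho; rewrite zV Evec scale1r dvec dotv0r.
  have := zero rho.
  by rewrite /kx dotvDl dotvNl dotvZl !dotvDr qformE (dotvC x (lincv _ _)); nra.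
have [[tau ktau]|nk] := pselect (exists tau, kx tau != 0).
  by exists (kx tau); split => //; have [] := Gkx tau.
(* If every [kx] vanishes, all the gradients at [x] lie in the range of [G], hence are orthogonal to
   the given kernel vector. *)
exists k0; split => // tau; have [_ <-] := Gkx tau.
have -> : kx tau = 0 by apply/eqP; apply: contra_notT nk => ?; exists tau.
by rewrite mulmx0 add0r (dotv_sym _ _ sG) Gk0 dotv0r.
Qed.

(** * Directional derivatives, first-order expansions and minima on spheres *)

Section CalculusOnColumns.
Variables (R : realType) (n : nat).
Implicit Types (x v w : 'cV[R]_n) (g : 'cV[R]_n -> R).

Lemma cV_norm_ge x i : `|x i 0| <= `|x|.
Proof.
rewrite [leRHS]/Num.norm /= mx_normrE; apply/bigmax_geP; right => /=.
by exists (i, 0).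
Qed.

Lemma cV_norm_le x c : 0 <= c -> (forall i, `|x i 0| <= c) -> `|x| <= c.
Proof.
move=> c0 xc; rewrite [leLHS]/Num.norm /= mx_normrE; apply/bigmax_leP; split => //.
by move=> [i j] _ /=; rewrite ord1.
Qed.

Lemma normr_dotv x v : `|dotv x v| <= n%:R * (`|x| * `|v|).
Proof.
rewrite dotvE (le_trans (ler_norm_sum _ _ _))//.
apply: (@le_trans _ _ (\sum_(i < n) `|x| * `|v|)).
  by apply: ler_sum => i _; rewrite normrM ler_pM// cV_norm_ge.
by rewrite sumr_const card_ord mulr_natl.
Qed.

Lemma near_ray (P : set 'cV[R]_n) x v : (\forall s \near x, P s) ->
  exists2 d, 0 < d & forall t : R, 0 < t < d -> P (x + t *: v).
Proof.
move=> /nbhs_normP [e /= e0 Pe]; exists (e / (`|v| + 1)).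
  by rewrite divr_gt0// ltr_wpDl.
move=> t /andP [t0]; rewrite ltr_pdivlMr ?ltr_wpDl// => te.
apply: Pe => /=; rewrite opprD addNKr normrN normrZ gtr0_norm//.
by apply: le_lt_trans te; rewrite ler_pM2l//; lra.
Qed.

Lemma is_derive_cvg (f : 'cV[R]_n -> R) x v (a : R) :
  (forall e, 0 < e -> exists2 d, 0 < d & forall t : R, t != 0 -> `|t| < d ->
     `|f (x + t *: v) - f x - t * a| <= e * `|t|) -> is_derive x v f a.
Proof.
move=> fa; have cf : (fun h => h^-1 *: ((f \o shift x) (h *: v) - f x)) @ 0^' --> a.
  apply/cvgrPdist_le => e e0; have [d d0 Hd] := fa e e0.
  exists d => //= t /=; rewrite sub0r normrN => td t0.
  have t0' : 0 < `|t| by rewrite normr_gt0.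
  rewrite -(ler_pM2r t0') -normrM mulrBl distrC mulrC.
  have := Hd t t0 td; rewrite [x + _]addrC (mulrC t a); congr (`|_| <= _).
  by rewrite /GRing.scale /= mulrA mulfV// mul1r.
by apply: DeriveDef; [apply/cvg_ex; exists a | exact/cvg_lim].
Qed.

Lemma is_derive_ray (f : 'cV[R]_n -> R) x v (a : R) : is_derive x v f a ->
  forall e, 0 < e -> exists2 d, 0 < d & forall t : R, 0 < t < d ->
     `|f (x + t *: v) - f x - t * a| <= e * t.
Proof.
case=> df fa e e0; have /cvgrPdist_le/(_ e e0) :
    (fun h => h^-1 *: ((f \o shift x) (h *: v) - f x)) @ 0^' --> a.
  by rewrite -fa; exact: df.
move=> [d /= d0 Hd]; exists d => // t /andP [t0 td].
have := Hd t; rewrite /= sub0r normrN gtr0_norm// => /(_ td (lt0r_neq0 t0)).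
rewrite -(ler_pM2r t0) -[X in _ * X <= _](gtr0_norm t0) -normrM mulrBl distrC.
rewrite mulrC [x + _]addrC (mulrC t a); congr (`|_| <= _).
by rewrite /GRing.scale /= mulrA mulfV ?gt_eqF// mul1r.
Qed.

Lemma is_derive_quadratic (f : 'cV[R]_n -> R) x v (a c : R) :
  (forall t : R, f (x + t *: v) = f x + t * a + t ^+ 2 * c) -> is_derive x v f a.
Proof.
move=> fq; apply: is_derive_cvg => e e0; exists (e / (`|c| + 1)).
  by rewrite divr_gt0// ltr_wpDl.
move=> t t0; rewrite ltr_pdivlMr ?ltr_wpDl// => te; rewrite fq.
rewrite (_ : _ - t * a = t * (t * c)); last by ring.
rewrite normrM mulrC ler_pM2r ?normr_gt0// normrM.
by apply/ltW; apply: le_lt_trans te; rewrite ler_pM2l ?normr_gt0//; lra.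
Qed.

Lemma partial_MVT g x i c : (forall y, derivable g y (ev R i)) ->
  exists2 z, `|z| <= `|c| &
    g (x + c *: ev R i) - g x = c * pderiv g i (x + z *: ev R i).
Proof.
move=> dg; pose phi (t : R) := g (x + t *: ev R i).
have dphi (t : R) : is_derive t 1 phi (pderiv g i (x + t *: ev R i)).
  have E : (fun h => h^-1 *: ((phi \o shift t) (h *: 1) - phi t)) =
    (fun h => h^-1 *: ((g \o shift (x + t *: ev R i)) (h *: ev R i)
      - g (x + t *: ev R i))).
    apply/funext => h; rewrite /phi /= [h *: 1]mulr1 scalerDl.
    by congr (_ *: (g _ - _)); rewrite addrCA.
  by apply: DeriveDef; rewrite /derivable /derive /pderiv /derive E//; exact: dg.
have cphi a b : {within `[a, b], continuous phi}.
  by apply: derivable_within_continuous => t _; exact: ex_derive.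
have [c0|c0] := leP 0 c.
  have [z] := MVT_segment c0 (fun t _ => dphi t) (cphi 0 c).
  rewrite in_itv /= /phi scale0r addr0 subr0 => /andP [z0 zc] ->.
  by exists z; rewrite 1?mulrC// !ger0_norm.
have [z] := MVT_segment (ltW c0) (fun t _ => dphi t) (cphi c 0).
rewrite in_itv /= /phi scale0r addr0 sub0r => /andP [cz z0] gE.
exists z; first by rewrite (ltr0_norm c0) ler0_norm// lerN2.
by rewrite -opprB gE mulrN opprK mulrC.
Qed.

(** Continuous partial derivatives give a Fréchet expansion: move one coordinate at a time and apply
    the mean value theorem to each move. *)
Lemma C1_expansion g x : (forall i y, derivable g y (ev R i)) ->
  (forall i, continuous (pderiv g i)) ->
  forall e, 0 < e -> exists2 d, 0 < d & forall w, `|w| < d ->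
    `|g (x + w) - g x - dotv (grad g x) w| <= e * `|w|.
Proof.
move=> dg cg e e0; pose e' := e / n.+1%:R.
have e'0 : 0 < e' by rewrite divr_gt0// ltr0n.
have : \forall y \near x, forall i, `|pderiv g i x - pderiv g i y| <= e'.
  apply: (@filter_forall _ 'I_n (fun i y => `|pderiv g i x - pderiv g i y| <= e')
    (nbhs x) _).
  by move=> i; move/cvgrPdist_le: (cg i x) => /(_ _ e'0).
move=> /nbhs_normP [d /= d0 Hd]; exists d => // w wd.
(* Only the first [k] coordinates have moved at [p k], so consecutive points differ along a single
   [ev R k]. *)
pose p (k : nat) := x + \col_(i < n) (if (i < k)%N then w i 0 else 0).
have pS (k : 'I_n) : p k.+1 = p k + w k 0 *: ev R k.
  rewrite /p -addrA; congr (_ + _); apply/colP => i; rewrite !mxE ltnS andbT.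
  have [->|ik] := eqVneq i k; first by rewrite leqnn ltnn mulr1 add0r.
  by rewrite mulr0 addr0 leq_eqVlt (_ : _ == _ = false)//; exact/negbTE.
have dp (k : 'I_n) : exists2 z, `|z| <= `|w k 0| &
    g (p k.+1) - g (p k) = w k 0 * pderiv g k (p k + z *: ev R k).
  by rewrite pS; apply: partial_MVT.
have -> : g (x + w) - g x = \sum_(k < n) (g (p k.+1) - g (p k)).
  rewrite -(big_mkord xpredT (fun k => g (p k.+1) - g (p k))) telescope_sumr//.
  congr (g _ - g _); last first.
    by rewrite /p -[LHS]addr0; congr (_ + _); apply/colP => i; rewrite !mxE.
  by rewrite /p; congr (_ + _); apply/colP => i; rewrite !mxE ltn_ord.
rewrite dotvE -sumrB (le_trans (ler_norm_sum _ _ _))//.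
apply: (@le_trans _ _ (\sum_(k < n) e' * `|w|)).
  apply: ler_sum => k _; have [z zw ->] := dp k.
  rewrite !mxE (mulrC (pderiv _ _ _)) -mulrBr normrM mulrC ler_pM// ?cV_norm_ge//.
  rewrite distrC; apply: Hd => /=; apply: le_lt_trans wd.
  rewrite opprD /p opprD !addrA subrr add0r -opprD normrN; apply: cV_norm_le => // i.
  rewrite !mxE andbT; have [->|ik] := eqVneq i k.
    by rewrite ltnn add0r mulr1 (le_trans zw)// cV_norm_ge.
  by rewrite mulr0 addr0; case: ifP; rewrite ?normr0 ?cV_norm_ge.
rewrite sumr_const card_ord -mulr_natl mulrA ler_wpM2r//.
by rewrite /e' mulrCA ler_piMr ?(ltW e0)// ler_pdivrMr ?ltr0n// mul1r ler_nat.
Qed.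

(** Chain rule for an inner map that is exactly quadratic along the line, as [Lam] is. *)
Lemma is_derive_C1_comp g (L : 'cV[R]_n -> 'cV[R]_n) x v a c :
  (forall i y, derivable g y (ev R i)) -> (forall i, continuous (pderiv g i)) ->
  (forall t : R, L (x + t *: v) = L x + t *: a + t ^+ 2 *: c) ->
  is_derive x v (fun y => g (L y)) (dotv (grad g (L x)) a).
Proof.
move=> dg cg LE; apply: is_derive_cvg => e e0.
(* For [|t| < 1] the increment has norm at most [|t| * k]; [m] serves to absorb the second-order
   term into [e / 2 * |t|]. *)
pose k := `|a| + `|c| + 1; have k0 : 0 < k.
  by rewrite /k; have := normr_ge0 a; have := normr_ge0 c; lra.
pose m := n%:R * (`|grad g (L x)| * `|c|) + 1.
have m0 : 0 < m by rewrite ltr_wpDl// !mulr_ge0.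
have ek : 0 < e / 2 / k by rewrite !divr_gt0.
have [d d0 Hd] := C1_expansion (L x) dg cg ek.
exists (Num.min 1 (Num.min (d / k) (e / 2 / m))).
  by rewrite !lt_min ltr01 !divr_gt0.
move=> t t0; rewrite !lt_min => /and3P [t1 td te].
have t0' : 0 < `|t| by rewrite normr_gt0.
pose w := t *: a + t ^+ 2 *: c.
have wk : `|w| <= `|t| * k.
  rewrite (le_trans (ler_normD _ _))// !normrZ -mulrA -mulrDr.
  rewrite ler_pM2l// /k -addrA lerD2l.
  have : `|t| * `|c| <= 1 * `|c| by rewrite ler_wpM2r// ltW.
  lra.
have wd : `|w| < d by rewrite (le_lt_trans wk)// -ltr_pdivlMr.
have := Hd w wd; rewrite LE -(addrA (L x)) -/w.
have -> : dotv (grad g (L x)) w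
    = t * dotv (grad g (L x)) a + t ^+ 2 * dotv (grad g (L x)) c.
  by rewrite dotvDr !dotvZr.
have gc : `|t ^+ 2 * dotv (grad g (L x)) c| <= e / 2 * `|t|.
  rewrite expr2 -[X in `|X|]mulrA normrM (mulrC `|t|) ler_pM2r// normrM.
  apply: (@le_trans _ _ (`|t| * m)); last by rewrite -ler_pdivlMr// ltW.
  by rewrite ler_pM2l// (le_trans (normr_dotv _ _))// /m; lra.
move: (g _ - g _) (t * _) (t ^+ 2 * _) gc => p q r gc pq.
rewrite (_ : p - q = (p - (q + r)) + r); last by ring.
apply: le_trans (ler_normD _ _) _; apply: le_trans (lerD pq gc) _.
rewrite [X in _ <= X](_ : _ = e / 2 * `|t| + e / 2 * `|t|); last by field.
rewrite lerD2r; apply: (@le_trans _ _ (e / 2 / k * (`|t| * k))).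
  by rewrite ler_wpM2l// ltW.
by rewrite mulrCA divfK ?gt_eqF// mulrC.
Qed.

Lemma is_derive_C1 g x v :
  (forall i y, derivable g y (ev R i)) -> (forall i, continuous (pderiv g i)) ->
  is_derive x v g (dotv (grad g x) v).
Proof.
move=> dg cg; apply: (@is_derive_C1_comp g id x v v 0 dg cg) => t.
by rewrite scaler0 addr0.
Qed.

(** Differentiability makes the directional derivative linear in [v], so zero partial derivatives
    suffice for every direction. *)
Lemma critical_point_ray g x v : critical_point g x ->
  forall e, 0 < e -> exists2 d, 0 < d & forall t : R, 0 < t < d ->
     `|g (x + t *: v) - g x| <= e * t.
Proof.
move=> [dg gg].
have D0 : is_derive x v g 0.
  apply: DeriveDef; first exact: diff_derivable.
  rewrite deriveE// (_ : v = \sum_i v i 0 *: ev R i).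
    rewrite linear_sum big1// => i _; rewrite linearZ /= -deriveE//.
    by move/colP: gg => /(_ i); rewrite !mxE /pderiv => ->; rewrite scaler0.
  apply/colP => j; rewrite summxE (bigD1 j)//= big1 => [|i /negbTE ij].
    by rewrite !mxE !eqxx mulr1 addr0.
  by rewrite !mxE eq_sym ij mulr0.
move=> e e0; have [d d0 Hd] := is_derive_ray D0 e0.
by exists d => // t /Hd; rewrite mulr0 subr0.
Qed.

End CalculusOnColumns.

Lemma trmx_rV_continuous (R : realType) n :
  continuous (fun v : 'rV[R]_n => v^T : 'cV[R]_n).
Proof.
move=> v; apply/(@cvgrPdist_le _ _ _ (nbhs v)) => e e0.
apply: filterS (nbhsx_ballx v e e0) => w [_ vw].
rewrite -linearB /=; apply: cV_norm_le; first exact: ltW.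
by move=> i; rewrite !mxE; exact/ltW/vw.
Qed.

(** Compactness is obtained on row vectors and carried over by transposition. *)
Lemma sphere_min (R : realType) n (h : 'cV[R]_n -> R) (r : R) (x0 : 'cV[R]_n) :
  continuous h -> `|x0| = r ->
  exists2 c, `|c| = r & forall x, `|x| = r -> h c <= h x.
Proof.
move=> ch x0r; pose S := [set v : 'rV[R]_n | `|v^T| = r].
have cT := @trmx_rV_continuous R n.
have cS : compact S.
  apply: bounded_closed_compact.
    exists r; split; first by rewrite num_real.
    move=> M rM v /= vr; rewrite /globally /= [leLHS]/Num.norm /= mx_normrE.
    have r0 : 0 <= r by rewrite -x0r.
    apply/bigmax_leP; split; first by rewrite (le_trans r0)// ltW.
    move=> [i j] _ /=; rewrite ord1; have := cV_norm_ge v^T j.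
    by rewrite mxE vr => /le_trans; apply; exact: ltW.
  rewrite (_ : S = (fun v : 'rV[R]_n => `|v^T|) @^-1` [set r])//.
  apply: preimage_closed.
    2: exact: (accessible_closed_set1 (hausdorff_accessible (@Rhausdorff R))).
  by move=> v _; apply: (continuous_comp (cT v)); exact: norm_continuous.
have S0 : S !=set0 by exists x0^T; rewrite /S /= trmxK.
have ch' : {within S, continuous (fun v : 'rV[R]_n => h v^T)}.
  by apply: continuous_subspaceT => v; apply: (continuous_comp (cT v)); exact: ch.
have [c /set_mem cSr hc] := compact_EVT_min S0 cS ch'.
exists c^T => // x xr; have := hc x^T; rewrite !trmxK; apply.
by rewrite inE /S /= trmxK.
Qed.

(** * Tangent inequalities and inverse gradient of a strictly convex function *)

Section StrictlyConvex.
Variables (R : realType) (n : nat) (V : 'cV[R]_n -> R).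
Hypotheses (hV : strictly_convex V) (V2 : C2 V).
Implicit Types x y s : 'cV[R]_n.

Let dV i x : derivable V x (ev R i). Proof. by have [_ [dV _]] := V2. Qed.
Let cdV i : continuous (pderiv V i). Proof. by have [_ [_ [cV _]]] := V2. Qed.

(** The chord inequality divided by [t], for small [t]. *)
Lemma convex_grad_le x y : V x + dotv (grad V x) (y - x) <= V y.
Proof.
have [->|xy] := eqVneq y x; first by rewrite subrr dotv0r addr0.
apply/ler_addgt0Pr => e e0.
have [d d0 Hd] := is_derive_ray (is_derive_C1 x (y - x) dV cdV) e0.
pose t := Num.min (d / 2) 2^-1.
have t0 : 0 < t by rewrite lt_min divr_gt0//=; lra.
have t1 : t < 1 by rewrite gt_min; apply/orP; right; lra.
have td : t < d by rewrite gt_min; apply/orP; left; lra.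
have := Hd t; rewrite t0 td => /(_ isT); rewrite ler_norml => /andP [+ _].
have := hV xy t0 t1.
have -> : t *: y + (1 - t) *: x = x + t *: (y - x).
  by apply/colP => i; rewrite !mxE; ring.
move: (V (x + _)) (V x) (V y) (dotv _ _) => a b c g h1 h2.
by rewrite -(ler_pM2l t0); nra.
Qed.

(** The tangent inequality at the midpoint, combined with strict convexity there. *)
Lemma convex_grad_lt x y : y != x -> V x + dotv (grad V x) (y - x) < V y.
Proof.
move=> yx; have h0 : (0 : R) < 2^-1 by lra.
have := hV yx h0 ltac:(lra).
have := convex_grad_le x (2^-1 *: y + (1 - 2^-1) *: x).
have -> : 2^-1 *: y + (1 - 2^-1) *: x - x = 2^-1 *: (y - x).
  by apply/colP => i; rewrite !mxE; field.
rewrite dotvZr; lra.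
Qed.

Lemma grad_inj : injective (grad V).
Proof.
move=> x y gxy; apply/eqP/negPn/negP => xy.
have := convex_grad_lt xy; rewrite eq_sym in xy; have := convex_grad_lt xy.
rewrite gxy -(opprB y x) dotvNr; lra.
Qed.

(** Continuity of the inverse gradient at [grad V x0] along a ray: the gap between [V] and its
    tangent at [x0] has a positive minimum on a small sphere, so a point outside it cannot have a
    gradient too close to [grad V x0]. *)
Lemma grad_inv_ray x0 v : forall e, 0 < e ->
  exists2 d, 0 < d & forall t x, 0 < t < d -> grad V x = grad V x0 + t *: v ->
    `|dotv v (x - x0)| <= e.
Proof.
move=> e e0; pose C := n%:R * `|v| + 1; have C0 : 0 < C by rewrite ltr_wpDl// mulr_ge0.
have dvC z : `|dotv v z| <= C * `|z|.
  by rewrite (le_trans (normr_dotv _ _))// mulrA ler_wpM2r// /C; lra.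
pose h z := V (x0 + z) - V x0 - dotv (grad V x0) z.
pose r := e / C; have r0 : 0 < r by rewrite divr_gt0.
(* In dimension zero the sphere is empty and [x0] is the only point. *)
have [[z0 z0r]|nor] := pselect (exists z : 'cV[R]_n, `|z| = r); last first.
  exists 1 => // t x _ _; suff -> : x = x0 by rewrite subrr dotv0r normr0 ltW.
  apply/eqP/negPn/negP => xx0; apply: nor.
  have xp : 0 < `|x - x0| by rewrite normr_gt0 subr_eq0.
  exists ((r / `|x - x0|) *: (x - x0)); rewrite normrZ gtr0_norm ?divr_gt0//.
  by rewrite divfK ?gt_eqF.
have [cV _] := V2.
have ct : continuous (fun z : 'cV[R]_n => x0 + z).
  by move=> z; apply: continuousD => //; exact: cst_continuous.
have c1 : continuous (fun z : 'cV[R]_n => V (x0 + z)).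
  by move=> z; exact: (continuous_comp (ct z) (cV _)).
have c2 : continuous (dotv (grad V x0)).
  move=> z; apply/(@cvgrPdist_le _ _ _ (nbhs z)) => a a0.
  pose D := n%:R * `|grad V x0| + 1.
  have D0 : 0 < D by rewrite ltr_wpDl// mulr_ge0.
  apply: filterS (nbhsx_ballx z _ (divr_gt0 a0 D0)) => w; rewrite mx_norm_ball /=.
  rewrite /ball_ /= ltr_pdivlMr// => wz; rewrite -dotvNr -dotvDr.
  rewrite (le_trans (normr_dotv _ _))//; apply: le_trans (ltW wz).
  by rewrite mulrA mulrC ler_wpM2l// /D; lra.
have ch : continuous h.
  move=> z; have c0 := @cst_continuous _ _ (V x0) z.
  exact: (continuousB (continuousB (c1 z) c0) (c2 z)).
have [c cr hc] := sphere_min ch z0r.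
have hc0 : 0 < h c.
  have c0 : x0 + c != x0.
    by rewrite -subr_eq0 addrC addKr -normr_gt0 cr.
  have := convex_grad_lt c0; rewrite [x0 + c]addrC addrK /h [x0 + c]addrC; lra.
(* Below this threshold a point outside the sphere would give [h c <= t * (r * C) < h c]. *)
exists (h c / (r * C)); first by rewrite divr_gt0// mulr_gt0.
move=> t x /andP [t0 tlt] gx.
have [xr|rx] := ltP `|x - x0| r.
  rewrite (le_trans (dvC _))// mulrC -ler_pdivlMr//; exact: ltW.
have xp : 0 < `|x - x0| by exact: lt_le_trans rx.
(* At the scale of the sphere, convexity gives [h c <= (r / |x - x0|) h (x - x0)],
   while the gradient inequality at [x] bounds [h (x - x0)] by [t <v, x - x0>]. *)
pose th := r / `|x - x0|.
have th0 : 0 < th by rewrite divr_gt0.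
have th1 : th <= 1 by rewrite ler_pdivrMr// mul1r.
have hx : h (x - x0) <= t * (C * `|x - x0|).
  have := convex_grad_le x x0; rewrite gx dotvDl dotvZl -(opprB x x0) !dotvNr.
  have : t * dotv v (x - x0) <= t * (C * `|x - x0|).
    by rewrite ler_pM2l// (le_trans (ler_norm _))//.
  by rewrite /h (_ : x0 + (x - x0) = x); [lra | rewrite addrC subrK].
have hth : h c <= th * h (x - x0).
  apply: (@le_trans _ _ (h (th *: (x - x0)))).
    by apply: hc; rewrite normrZ gtr0_norm// /th divfK ?gt_eqF.
  have [th1'|th1'] := ltP th 1; last first.
    have -> : th = 1 by apply/eqP; rewrite eq_le th1.
    by rewrite scale1r mul1r.
  have xx0 : x != x0 by rewrite -subr_eq0 -normr_gt0.
  have := hV xx0 th0 th1'.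
  have -> : th *: x + (1 - th) *: x0 = x0 + th *: (x - x0).
    by apply/colP => i; rewrite !mxE; ring.
  rewrite /h dotvZr (_ : x0 + (x - x0) = x); last by rewrite addrC subrK.
  move: (V (x0 + _)) => a; nra.
have rC0 : 0 < r * C by exact: mulr_gt0.
exfalso; move: tlt; rewrite ltr_pdivlMr// ltNge => /negP; apply.
apply: le_trans hth _; apply: le_trans (_ : _ <= th * (t * (C * `|x - x0|))) _.
  by rewrite ler_pM2l.
rewrite le_eqVlt; apply/orP; left; apply/eqP; rewrite /th; field.
by rewrite normr_eq0 -normr_gt0.
Qed.

End StrictlyConvex.

(** * The Legendre conjugate and its derivative along rays *)

Section Conjugate.
Variables (R : realType) (n : nat) (B : 'I_n -> 'M[R]_n) (b : 'I_n -> 'cV[R]_n).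
Variable V : 'cV[R]_n -> R.
Hypotheses (hV : strictly_convex V) (V2 : C2 V).

Lemma VstarE s : Vastar B b V s ->
  exists xi, [/\ Va B b xi, grad V xi = s & Vstar B b V s = dotv xi s - V xi].
Proof.
move=> [xi Vxi gxi]; pose P := [set xi | Va B b xi /\ grad V xi = s].
have : P (xget 0 P) by apply: (xgetPex 0); exists xi.
by case=> Vx gx; exists (xget 0 P).
Qed.

(** Injectivity of the gradient identifies the chosen preimage with [xi]. *)
Lemma Vstar_grad xi : Vastar B b V (grad V xi) ->
  Vstar B b V (grad V xi) = dotv xi (grad V xi) - V xi.
Proof. by move=> /VstarE [y [_ /(grad_inj hV V2) -> ->]]. Qed.

Lemma Young s xi : Vastar B b V s -> dotv xi s - V xi <= Vstar B b V s.
Proof.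
move=> /VstarE [y [_ <- ->]]; have := convex_grad_le hV V2 y xi.
rewrite dotvDr dotvNr (dotvC xi) (dotvC y); lra.
Qed.

(** Young's inequality at the two ends of the segment traps the increment between [t * dotv v xi]
    and [t * dotv v y], with [y] the preimage at the moved point; [grad_inv_ray] brings these bounds
    together. *)
Lemma Vstar_ray xi v : Vastar B b V (grad V xi) -> forall e, 0 < e ->
  exists2 d, 0 < d & forall t : R, 0 < t < d -> Vastar B b V (grad V xi + t *: v) ->
    `|Vstar B b V (grad V xi + t *: v) - Vstar B b V (grad V xi) - t * dotv v xi|
      <= e * t.
Proof.
move=> Vs e e0; have [d d0 Hd] := grad_inv_ray hV V2 xi v e0.
exists d => // t td Vst; have [y [_ gy Ey]] := VstarE Vst.
have := Hd t y td gy; rewrite !ler_norml => /andP [_ dy].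
have := Young xi Vst; have := Young y Vs; rewrite Ey Vstar_grad//.
have t0 : 0 < t by case/andP: td.
have : t * dotv v (y - xi) <= e * t by rewrite mulrC ler_pM2r.
rewrite !(dotvDr, dotvZr, dotvNr) (dotvC y v) (dotvC xi v).
move=> h1 h2 h3; apply/andP; split; nra.
Qed.

End Conjugate.

(** * First and second derivatives of the primal function *)

Section Primal.
Variables (R : realType) (n : nat) (A : 'M[R]_n) (f : 'cV[R]_n).
Variables (B : 'I_n -> 'M[R]_n) (b : 'I_n -> 'cV[R]_n) (V : 'cV[R]_n -> R).
Hypotheses (sA : A^T = A) (sB : forall k, (B k)^T = B k).
Implicit Types (x y z v s : 'cV[R]_n).

Lemma GmDZ s (t : R) v : Gm A B (s + t *: v) = Gm A B s + t *: linmx B v.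
Proof. by rewrite -addrA -linmxDZ. Qed.

Lemma FvDZ s (t : R) v : Fv f b (s + t *: v) = Fv f b s - t *: lincv b v.
Proof. by rewrite /Fv -/(lincv b _) lincvDZ opprD addrA. Qed.

Lemma Gm_sym s : (Gm A B s)^T = Gm A B s.
Proof. by rewrite /Gm linearD /= sA -/(linmx B s) linmx_sym. Qed.

Lemma dotv_linmx s x v : dotv (linmx B s *m x) v = \sum_k s k 0 * dotv (B k *m x) v.
Proof.
rewrite /linmx mulmx_suml dotv_suml; apply: eq_bigr => k _.
by rewrite -scalemxAl dotvZl.
Qed.

Lemma dotv_lincv s v : dotv (lincv b s) v = \sum_k s k 0 * dotv (b k) v.
Proof. by rewrite /lincv dotv_suml; apply: eq_bigr => k _; rewrite dotvZl. Qed.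

Lemma dotv_Lam s x :
  dotv s (Lam B b x) = 2^-1 * qform (linmx B s) x + dotv (lincv b s) x.
Proof.
rewrite qformE dotvC dotv_lincv (dotvC x) dotv_linmx mulr_sumr -big_split dotvE.
by apply: eq_bigr => k _; rewrite !mxE /= qformE (dotvC x); ring.
Qed.

(** The differential of [Lam] at [x] along [v], for symmetric [B k]. *)
Definition dLam x v : 'cV[R]_n := \col_k dotv (B k *m x + b k) v.

Lemma dLamE x v k : dLam x v k 0 = dotv (B k *m x + b k) v.
Proof. by rewrite mxE. Qed.

Lemma LamDZ x (t : R) v : Lam B b (x + t *: v)
  = Lam B b x + t *: dLam x v + t ^+ 2 *: \col_k (2^-1 * qform (B k) v).
Proof.
apply/colP => k; rewrite !mxE !qformE mulmxDr -scalemxAr.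
rewrite !(dotvDl, dotvDr, dotvZl, dotvZr) (dotv_sym x v (sB k)) (dotvC (B k *m x) v).
by field.
Qed.

Lemma dotv_dLam s x v : dotv s (dLam x v) = dotv (linmx B s *m x + lincv b s) v.
Proof.
rewrite dotvDl dotv_linmx dotv_lincv -big_split dotvE.
by apply: eq_bigr => k _; rewrite !mxE /= dotvDl mulrDr.
Qed.

(** The part of the total complementary function [Xi x s] left after removing [- V^* s]. *)
Definition total_quadratic s x : R := 2^-1 * qform (Gm A B s) x - dotv x (Fv f b s).

Lemma total_quadraticE s x :
  total_quadratic s x = dotv s (Lam B b x) + (2^-1 * qform A x - dotv x f).
Proof.
rewrite dotv_Lam /total_quadratic /Gm /Fv -/(linmx B s) -/(lincv b s) !qformE.
by rewrite mulmxDl !dotvDr dotvNr (dotvC x (lincv _ _)); ring.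
Qed.

(** Valid for every [s]; Young's inequality bounds the bracket by [V^* s] on the dual domain. *)
Lemma PiE s x : Pi A f B b V x
  = total_quadratic s x - (dotv (Lam B b x) s - V (Lam B b x)).
Proof. by rewrite total_quadraticE /Pi (dotvC s); ring. Qed.

Lemma total_quadratic_shift s x v : Gm A B s *m x = Fv f b s ->
  total_quadratic s (x + v) = total_quadratic s x + 2^-1 * qform (Gm A B s) v.
Proof.
move=> Gx; rewrite /total_quadratic !qformE mulmxDr -Gx !(dotvDl, dotvDr).
by rewrite (dotv_sym x v (Gm_sym s)); field.
Qed.

Hypothesis V2 : C2 V.

Let dV i y : derivable V y (ev R i). Proof. by have [_ [dV _]] := V2. Qed.
Let cdV i : continuous (pderiv V i). Proof. by have [_ [_ [cV _]]] := V2. Qed.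
Let ddV i j y : derivable (pderiv V i) y (ev R j).
Proof. by have [_ [_ [_ [ddV _]]]] := V2. Qed.
Let cddV i j : continuous (pderiv (pderiv V i) j).
Proof. by have [_ [_ [_ [_ cddV]]]] := V2. Qed.

Lemma grad_Pi x : grad (Pi A f B b V) x
  = Gm A B (grad V (Lam B b x)) *m x - Fv f b (grad V (Lam B b x)).
Proof.
apply/colP => i; rewrite mxE -[RHS]dotv_ev.
set s := grad V (Lam B b x).
have -> : Gm A B s *m x - Fv f b s = (linmx B s *m x + lincv b s) + (A *m x - f).
  rewrite /Gm /Fv -/(linmx B s) -/(lincv b s) mulmxDl.
  by apply/colP => j; rewrite !mxE; ring.
rewrite dotvDl -dotv_dLam /pderiv.
have dL := is_derive_C1_comp dV cdV (fun t => LamDZ x t (ev R i)).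
have dA : is_derive x (ev R i) (fun y => 2^-1 * qform A y - dotv y f)
    (dotv (A *m x - f) (ev R i)).
  apply: (is_derive_quadratic (c := 2^-1 * qform A (ev R i))) => t.
  rewrite !qformE mulmxDr -scalemxAr !(dotvDl, dotvDr, dotvZl, dotvZr, dotvNl).
  by rewrite (dotv_sym x (ev R i) sA) (dotvC (A *m x)) (dotvC f); field.
rewrite (_ : Pi A f B b V = (fun y => V (Lam B b y))
    + (fun y => 2^-1 * qform A y - dotv y f)).
  exact: derive_val.
by apply/funext => y; rewrite fctE /Pi addrA.
Qed.

(** The Hessian is [Gm] at [grad V (Lam x)] plus the Hessian of [V] pulled back by the differential
    of [Lam]; [z] is annihilated by both terms. *)
Lemma hessian_Pi_kernel x z :
  Gm A B (grad V (Lam B b x)) *m z = 0 -> dLam x z = 0 ->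
  hessian (Pi A f B b V) x *m z = 0.
Proof.
move=> Gz Lz; apply/colP => i; rewrite !mxE.
pose lin k y : R := (B k *m y + b k) i 0.
have dlin k j : is_derive x (ev R j) (lin k) (B k i j).
  apply: (is_derive_quadratic (c := 0)) => t.
  by rewrite /lin mulmxDr -scalemxAr -colE !mxE; ring.
have pE : pderiv (Pi A f B b V) i
    = \sum_(k < n) ((fun y => pderiv V k (Lam B b y)) * lin k)
      + (fun y => (A *m y - f) i 0).
  apply/funext => y; have := grad_Pi y => /colP/(_ i); rewrite mxE => ->.
  transitivity (\sum_(k < n) pderiv V k (Lam B b y) * lin k y + (A *m y - f) i 0).
    rewrite /Gm /Fv -/(linmx B _) -/(lincv b _).
    set s := grad V (Lam B b y).
    have -> : (A + linmx B s) *m y - (f - lincv b s)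
        = linmx B s *m y + lincv b s + (A *m y - f).
      by rewrite mulmxDl; apply/colP => j; rewrite !mxE; ring.
    rewrite mxE; congr (_ + _).
    rewrite /linmx /lincv mulmx_suml -big_split summxE; apply: eq_bigr => k _.
    by rewrite -scalemxAl /= -scalerDr mxE mxE.
  by rewrite -[RHS]/((\sum_(k < n) ((fun y => pderiv V k (Lam B b y)) * lin k)) y
    + (A *m y - f) i 0) fct_sumE.
have dA j : is_derive x (ev R j) (fun y => (A *m y - f) i 0) (A i j).
  apply: (is_derive_quadratic (c := 0)) => t.
  by rewrite mulmxDr -scalemxAr -colE !mxE; ring.
have hE j : hessian (Pi A f B b V) x i j
    = \sum_(k < n) (pderiv V k (Lam B b x) * B k i j
        + lin k x * dotv (grad (pderiv V k) (Lam B b x)) (dLam x (ev R j))) + A i j.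
  rewrite mxE pE /pderiv; apply: derive_val.
  apply: is_deriveD; apply: is_derive_sum => k.
  have dVk := is_derive_C1_comp (@ddV k) (@cddV k) (fun t => LamDZ x t (ev R j)).
  exact: is_deriveM.
under eq_bigr => j _ do rewrite hE mulrDl mulr_suml.
rewrite big_split /= exchange_big /=.
transitivity ((Gm A B (grad V (Lam B b x)) *m z) i 0); last by rewrite Gz mxE.
rewrite /Gm mulmxDl mulmx_suml !mxE summxE addrC; congr (_ + _).
apply: eq_bigr => k _; rewrite -scalemxAl !mxE mulr_sumr.
rewrite (eq_bigr (fun j => pderiv V k (Lam B b x) * (B k i j * z j 0) +
    lin k x * (dotv (grad (pderiv V k) (Lam B b x)) (z j 0 *: dLam x (ev R j))))).
  rewrite big_split /= -[RHS]addr0; congr (_ + _).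
  rewrite -mulr_sumr; under eq_bigr => j _ do rewrite dotvC.
  rewrite -dotv_suml (_ : \sum_j _ = 0) ?dotv0l ?mulr0// -[RHS]Lz.
  apply/colP => l; rewrite summxE dLamE dotvE; apply: eq_bigr => j _.
  by rewrite mxE dLamE dotv_ev mulrC.
by move=> j _; rewrite dotvZr; ring.
Qed.

Lemma singular_hessian_Pi x z : z != 0 ->
  Gm A B (grad V (Lam B b x)) *m z = 0 -> dLam x z = 0 ->
  \det (hessian (Pi A f B b V) x) = 0.
Proof.
move=> z0 Gz Lz; apply/eqP; rewrite -det_tr; apply/det0P; exists z^T.
  by rewrite -(inj_eq trmx_inj) trmxK trmx0.
by rewrite -trmx_mul hessian_Pi_kernel// trmx0.
Qed.

End Primal.

(** * Coercivity, operator bounds and continuity of [Lam] *)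

(** Each coordinate [v i] is the [M]-product of [v] with a solution of [M *m y = ev R i], so
    Cauchy-Schwarz bounds its square by a multiple of [qform M v]. *)
Lemma posdef_coercive (R : realType) n (M : 'M[R]_n) : M^T = M ->
  (forall v, v != 0 -> 0 < qform M v) ->
  exists2 c, 0 < c & forall v, c * `|v| ^+ 2 <= qform M v.
Proof.
move=> sM pM.
have psdM : psdmx M.
  move=> v; have [->|/pM/ltW//] := eqVneq v 0.
  by rewrite qformE dotv0l.
have sol i : exists y, M *m y = ev R i.
  apply: symmetric_solvable => // v Mv; have [->|v0] := eqVneq v 0.
    by rewrite dotv0l.
  by have := pM _ v0; rewrite qformE Mv dotv0r ltxx.
pose K := \sum_i qform M (sval (cid (sol i))) + 1.
have K0 : 0 < K by rewrite ltr_wpDl// sumr_ge0.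
exists K^-1; first by rewrite invr_gt0.
move=> v; rewrite mulrC ler_pdivrMr// -[leRHS]sqr_sqrtr ?mulr_ge0// ?(ltW K0)//.
rewrite lerXn2r ?nnegrE ?sqrtr_ge0//; apply: cV_norm_le => [|i].
  exact: sqrtr_ge0.
rewrite -sqrtr_sqr ler_wsqrtr//.
have := psd_CauchySchwarz v (sval (cid (sol i))) sM psdM.
rewrite {1}(svalP (cid (sol i))) dotv_ev => /le_trans; apply.
rewrite ler_wpM2l// /K (bigD1 i)//= -addrA lerDl addr_ge0//.
exact: sumr_ge0.
Qed.

Lemma cV_norm_mulmx (R : realType) n (M : 'M[R]_n) (v : 'cV[R]_n) :
  `|M *m v| <= (\sum_i \sum_j `|M i j|) * `|v|.
Proof.
apply: cV_norm_le => [|i].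
  by rewrite mulr_ge0// sumr_ge0// => i _; rewrite sumr_ge0.
rewrite mxE (le_trans (ler_norm_sum _ _ _))//.
apply: (@le_trans _ _ ((\sum_j `|M i j|) * `|v|)).
  by rewrite mulr_suml ler_sum// => j _; rewrite normrM ler_wpM2l// cV_norm_ge.
rewrite ler_wpM2r// [leRHS](bigD1 i)//= lerDl sumr_ge0// => k _.
by rewrite sumr_ge0.
Qed.

Section LinearBounds.
Variables (R : realType) (n : nat) (B : 'I_n -> 'M[R]_n) (b : 'I_n -> 'cV[R]_n).

Lemma normr_linmx s (v : 'cV[R]_n) :
  `|linmx B s *m v| <= (\sum_k \sum_i \sum_j `|B k i j|) * `|s| * `|v|.
Proof.
rewrite /linmx mulmx_suml (le_trans (ler_norm_sum _ _ _))// !mulr_suml ler_sum//.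
move=> k _; rewrite -scalemxAl normrZ mulrAC [leLHS]mulrC ler_pM// ?cV_norm_ge//.
exact: cV_norm_mulmx.
Qed.

Lemma normr_lincv s : `|lincv b s| <= (\sum_k `|b k|) * `|s|.
Proof.
rewrite /lincv (le_trans (ler_norm_sum _ _ _))// !mulr_suml ler_sum//.
by move=> k _; rewrite normrZ mulrC ler_wpM2l// cV_norm_ge.
Qed.

End LinearBounds.

Lemma near_cV (R : realType) n (P : set 'cV[R]_n) (x : 'cV[R]_n) :
  (exists2 d, 0 < d & forall y, `|y - x| < d -> P y) <-> nbhs x P.
Proof.
split=> [[d d0 dP]|/nbhs_normP [d /= d0 dP]].
  apply: filterS (nbhsx_ballx x _ d0) => y; rewrite mx_norm_ball /ball_ /= => yd.
  by apply: dP; rewrite distrC.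
by exists d => // y yd; apply: dP; rewrite /= distrC.
Qed.

Section LamContinuity.
Variables (R : realType) (n : nat) (B : 'I_n -> 'M[R]_n) (b : 'I_n -> 'cV[R]_n).
Hypothesis sB : forall k, (B k)^T = B k.

(** In the exact expansion [LamDZ], [K1] bounds the linear term and [K2] the quadratic one for
    increments shorter than 1. *)
Lemma Lam_near (x : 'cV[R]_n) (U : set 'cV[R]_n) : nbhs (Lam B b x) U ->
  \forall y \near x, U (Lam B b y).
Proof.
move=> /near_cV [r r0 Hr].
pose K1 := \sum_k n%:R * `|B k *m x + b k|.
pose K2 := \sum_k n%:R * (\sum_i \sum_j `|B k i j|).
have K10 : 0 <= K1 by rewrite sumr_ge0// => k _; rewrite mulr_ge0.
have K2k k : 0 <= n%:R * (\sum_i \sum_j `|B k i j|).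
  by rewrite mulr_ge0// sumr_ge0// => i _; rewrite sumr_ge0.
have K20 : 0 <= K2 by rewrite sumr_ge0.
pose K := K1 + K2 + 1; have K0 : 0 < K by rewrite /K; lra.
apply/near_cV; exists (Num.min 1 (r / K)); first by rewrite lt_min ltr01 divr_gt0.
move=> y; rewrite lt_min => /andP [y1]; rewrite ltr_pdivlMr// => yr.
apply: Hr; pose v := y - x.
have -> : y = x + 1 *: v by rewrite scale1r addrC subrK.
rewrite LamDZ// expr1n !scale1r -(addrA (Lam B b x)) addrAC subrr add0r.
apply: le_lt_trans yr; rewrite -/v (le_trans (ler_normD _ _))//.
apply: (@le_trans _ _ (`|v| * K1 + `|v| * K2)); last first.
  by rewrite -mulrDr ler_wpM2l// /K lerDl.
apply: lerD.
  apply: cV_norm_le => [|k]; first by rewrite mulr_ge0.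
  rewrite dLamE (le_trans (normr_dotv _ _))// mulrA mulrC ler_wpM2l//.
  by rewrite [leRHS](bigD1 k)//= lerDl sumr_ge0// => i _; rewrite mulr_ge0.
apply: cV_norm_le => [|k]; first by rewrite mulr_ge0.
rewrite mxE qformE normrM (le_trans (_ : _ <= 1 * `|dotv v (B k *m v)|))//.
  by rewrite ler_wpM2r// ger0_norm//; lra.
rewrite mul1r (le_trans (normr_dotv _ _))//.
apply: (@le_trans _ _ (n%:R * (`|v| * ((\sum_i \sum_j `|B k i j|) * 1)))).
  rewrite !ler_wpM2l// (le_trans (cV_norm_mulmx _ _))// ler_wpM2l ?(ltW y1)//.
  by rewrite sumr_ge0// => i _; rewrite sumr_ge0.
rewrite mulr1 mulrCA ler_wpM2l// [leRHS](bigD1 k)//= lerDl.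
by rewrite sumr_ge0.
Qed.

Lemma grad_Lam_near (V : 'cV[R]_n -> R) (x : 'cV[R]_n) (U : set 'cV[R]_n) : C2 V ->
  nbhs (grad V (Lam B b x)) U -> \forall y \near x, U (grad V (Lam B b y)).
Proof.
move=> [_ [_ [cV _]]] /near_cV [r r0 Hr].
apply: (@Lam_near x [set z | U (grad V z)]).
have : \forall z \near Lam B b x,
    forall i, `|pderiv V i (Lam B b x) - pderiv V i z| <= r / 2.
  apply: (@filter_forall _ 'I_n
    (fun i z => `|pderiv V i (Lam B b x) - pderiv V i z| <= r / 2)
    (nbhs (Lam B b x)) _) => i.
  by move/cvgrPdist_le: (cV i (Lam B b x)); apply; rewrite divr_gt0.
apply: filterS => z Hz; apply: Hr; apply: (@le_lt_trans _ _ (r / 2)); last lra.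
by apply: cV_norm_le => [|i]; [lra | rewrite !mxE distrC].
Qed.

End LamContinuity.

(** * Weak duality, stationarity and exchange of extrema *)

Section Duality.
Variables (R : realType) (n : nat) (A : 'M[R]_n) (f : 'cV[R]_n).
Variables (B : 'I_n -> 'M[R]_n) (b : 'I_n -> 'cV[R]_n).
Variables (V : 'cV[R]_n -> R) (ginv : 'M[R]_n -> 'M[R]_n).
Hypotheses (sA : A^T = A) (sB : forall k, (B k)^T = B k).
Hypotheses (hV : strictly_convex V) (V2 : C2 V) (hginv : is_ginv ginv).
Implicit Types (s x v : 'cV[R]_n).

Local Notation G := (Gm A B).
Local Notation F := (Fv f b).
Local Notation L := (Lam B b).
Local Notation phi := (total_quadratic A f B b).
Local Notation X := (xof A f B b ginv).
Local Notation Vs := (Vstar B b V).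
Local Notation D := (Pid A f B b V ginv).
Local Notation P := (Pi A f B b V).
Local Notation S := (Sa A f B b V).

Lemma xof_solution s : S s -> G s *m X s = F s.
Proof. by case=> _ [y Gy]; rewrite /xof -Gy !mulmxA hginv. Qed.

Lemma PidE s : S s -> D s = phi s (X s) - Vs s.
Proof.
move=> Ss; rewrite /Pid -/(xof A f B b ginv s) /total_quadratic qformE.
by rewrite xof_solution//; field.
Qed.

Lemma quadratic_ray s v (t : R) x : phi (s + t *: v) x = phi s x + t * dotv v (L x).
Proof. by rewrite !total_quadraticE dotvDl dotvZl; ring. Qed.

Lemma Pi_ge s x : S s -> phi s x - Vs s <= P x.
Proof.
by move=> [Vss _]; rewrite (PiE _ _ _ _ _ s); have := Young hV V2 (L x) Vss; lra.
Qed.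

Lemma Pi_grad x : S (grad V (L x)) ->
  P x = phi (grad V (L x)) x - Vs (grad V (L x)).
Proof. by move=> [Vss _]; rewrite (PiE _ _ _ _ _ (grad V (L x))) Vstar_grad. Qed.

Lemma quadratic_le_xof s x : S s -> (forall v, qform (G s) v <= 0) ->
  phi s x <= phi s (X s).
Proof.
move=> Ss neg; have := neg (x - X s).
have -> : phi s x = phi s (X s + (x - X s)) by rewrite addrC subrK.
by rewrite total_quadratic_shift ?xof_solution//; lra.
Qed.

Lemma quadratic_ge_xof s x : S s -> psdmx (G s) -> phi s (X s) <= phi s x.
Proof.
move=> Ss pos; have := pos (x - X s).
have -> : phi s x = phi s (X s + (x - X s)) by rewrite addrC subrK.
by rewrite total_quadratic_shift ?xof_solution//; lra.
Qed.

Variable s0 : 'cV[R]_n.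
Hypotheses (hdom : \forall s \near s0, S s) (hcrit : critical_point D s0).

Let S0 : S s0. Proof. exact: nbhs_singleton hdom. Qed.

(* [V^*] is differentiable at [s0] with gradient [xi], hence so is the quadratic part
   of the dual function. *)
Lemma quadratic_value_ray xi v : grad V xi = s0 -> forall e, 0 < e ->
  exists2 d, 0 < d & forall t : R, 0 < t < d ->
    `|phi (s0 + t *: v) (X (s0 + t *: v)) - phi s0 (X s0) - t * dotv v xi| <= e * t.
Proof.
move=> gxi e e0; have e2 : 0 < e / 2 by lra.
have [d1 d10 H1] := critical_point_ray v hcrit e2.
have [d2 d20 H2] : exists2 d, 0 < d & forall t : R, 0 < t < d ->
    Vastar B b V (s0 + t *: v) ->
    `|Vs (s0 + t *: v) - Vs s0 - t * dotv v xi| <= e / 2 * t.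
  by rewrite -gxi; apply: Vstar_ray => //; rewrite gxi; case: S0.
have [d3 d30 H3] := near_ray v hdom.
exists (Num.min d1 (Num.min d2 d3)); first by rewrite !lt_min d10 d20.
move=> t /andP [t0]; rewrite !lt_min => /and3P [t1 t2 t3].
have St : S (s0 + t *: v) by apply: H3; rewrite t0.
have := H1 t; rewrite t0 t1 => /(_ isT); rewrite PidE// PidE//.
have := H2 t; rewrite t0 t2 => /(_ isT); case: (St) => VSt _ /(_ VSt).
set p := phi (s0 + t *: v) _; set q := phi s0 _; set c := Vs (s0 + _).
set d := Vs s0; set l := t * dotv v xi => h1 h2.
rewrite (_ : p - q - l = (p - c - (q - d)) + (c - d - l)); last by ring.
by rewrite (le_trans (ler_normD _ _))//; lra.
Qed.

(** Half of the coercivity constant at [s0] survives a small perturbation of [s]. *)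
Lemma negdef_near : negdefmx (G s0) -> exists2 c, 0 < c &
  \forall s \near s0, forall w, c * `|w| ^+ 2 <= - qform (G s) w.
Proof.
move=> neg; have nG0 v : v != 0 -> 0 < qform (- G s0) v.
  by move=> /neg; rewrite !qformE mulNmx dotvNr oppr_gt0.
have sG0 : (- G s0)^T = - G s0 by rewrite linearN /= Gm_sym.
have [c c0 Hc] := posdef_coercive sG0 nG0.
pose M := \sum_k \sum_i \sum_j `|B k i j|.
have M0 : 0 <= M.
  by do 2!(rewrite sumr_ge0// => ? _); rewrite sumr_ge0.
pose K := n%:R * M + 1; have K0 : 0 < K by rewrite ltr_wpDl// mulr_ge0.
exists (c / 2); first by rewrite divr_gt0.
apply/near_cV; exists (c / 2 / K); first by rewrite !divr_gt0.
move=> s; rewrite ltr_pdivlMr// => sc w; pose v := s - s0.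
have -> : s = s0 + 1 *: v by rewrite scale1r addrC subrK.
rewrite GmDZ scale1r qformE mulmxDl dotvDr -qformE.
have Hw : c * `|w| ^+ 2 <= - qform (G s0) w.
  by have := Hc w; rewrite !qformE mulNmx dotvNr.
suff : dotv w (linmx B v *m w) <= c / 2 * `|w| ^+ 2 by lra.
apply: (@le_trans _ _ (`|v| * K * `|w| ^+ 2)); last first.
  by rewrite ler_wpM2r ?exprn_ge0// ltW.
rewrite (le_trans (ler_norm _))// (le_trans (normr_dotv _ _))//.
apply: (@le_trans _ _ (n%:R * (`|w| * (M * `|v| * `|w|)))).
  by rewrite !ler_wpM2l// normr_linmx.
rewrite (_ : n%:R * _ = `|v| * (n%:R * M) * `|w| ^+ 2); last by ring.
by rewrite ler_wpM2r ?exprn_ge0// ler_wpM2l// /K; lra.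
Qed.

(** The difference [X s - X s0] solves a system with matrix [G s] and a right-hand side of order
    [s - s0]; the uniform coercivity near [s0] bounds it. *)
Lemma xof_near (U : set 'cV[R]_n) : negdefmx (G s0) -> nbhs (X s0) U ->
  \forall s \near s0, U (X s).
Proof.
move=> /negdef_near [c c0 Hc] /near_cV [r r0 Hr].
pose M := \sum_k \sum_i \sum_j `|B k i j|; pose m := \sum_k `|b k|.
have M0 : 0 <= M.
  by do 2!(rewrite sumr_ge0// => ? _); rewrite sumr_ge0.
have m0 : 0 <= m by rewrite sumr_ge0.
pose K := n%:R * (M * `|X s0| + m) + 1.
have K0 : 0 < K by rewrite ltr_wpDl// mulr_ge0// addr_ge0// mulr_ge0.
have near_c : \forall s \near s0, `|s - s0| < c * r / K.
  by apply/near_cV; exists (c * r / K) => //; rewrite divr_gt0// mulr_gt0.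
apply: filterS (filterI near_c (filterI Hc hdom)) => s [sd [cs Ss]].
apply: Hr; rewrite ltNge; apply/negP => rw.
pose w := X s - X s0; have w0 : 0 < `|w| by apply: lt_le_trans rw.
pose v := s - s0; have sv : s = s0 + 1 *: v by rewrite scale1r addrC subrK.
have Gw : G s *m w = - (linmx B v *m X s0 + lincv b v).
  have := @pencil_diff _ _ (G s0) (linmx B v) (F s0) (lincv b v) (X s0) (X s) 1.
  by rewrite -GmDZ -FvDZ -sv scaleN1r; apply; exact: xof_solution.
have := cs w; rewrite qformE Gw dotvNr opprK => h.
have : dotv w (linmx B v *m X s0 + lincv b v) <= `|w| * (`|v| * K).
  rewrite (le_trans (ler_norm _))// (le_trans (normr_dotv _ _))//.
  rewrite mulrCA ler_wpM2l//.
  apply: (@le_trans _ _ (n%:R * (M * `|v| * `|X s0| + m * `|v|))).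
    by rewrite ler_wpM2l// (le_trans (ler_normD _ _))// lerD ?normr_linmx ?normr_lincv.
  rewrite (_ : n%:R * _ = `|v| * (n%:R * (M * `|X s0| + m))); last by ring.
  by rewrite ler_wpM2l// /K; lra.
move=> /(le_trans h); rewrite expr2 mulrCA ler_pM2l// leNgt => /negP; apply.
move: sd; rewrite ltr_pdivlMr// => /lt_le_trans; apply.
by rewrite ler_pM2l.
Qed.

(** One-sided envelope argument: [X s0] competes in the maximum that defines the quadratic value at
    [s0 + t *: v], which gives an inequality for [v]; applied to [- v] as well, it becomes an
    equality. *)
Lemma stationary_neg : negdefmx (G s0) -> grad V (L (X s0)) = s0.
Proof.
move=> neg; have [xi [_ gxi _]] := VstarE S0.1.
suff -> : L (X s0) = xi by [].
have [c c0 Hc] := negdef_near neg.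
have le0 v : dotv v (L (X s0)) <= dotv v xi.
  apply/ler_addgt0Pr => e e0.
  have [d1 d10 H1] := quadratic_value_ray v gxi e0.
  have [d2 d20 H2] := near_ray v (filterI hdom Hc).
  pose t := Num.min (d1 / 2) (d2 / 2).
  have t0 : 0 < t by rewrite !lt_min !divr_gt0.
  have t1 : t < d1 by rewrite gt_min; apply/orP; left; lra.
  have t2 : t < d2 by rewrite gt_min; apply/orP; right; lra.
  have [St Gt] : [set s | S s /\
      (forall w, c * `|w| ^+ 2 <= - qform (G s) w)] (s0 + t *: v).
    by apply: H2; rewrite t0.
  have negt w : qform (G (s0 + t *: v)) w <= 0.
    by rewrite -oppr_ge0 (le_trans _ (Gt w))// mulr_ge0 ?exprn_ge0// ltW.
  have := quadratic_le_xof (X s0) St negt; rewrite quadratic_ray => h.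
  have := H1 t; rewrite t0 t1 => /(_ isT); rewrite ler_norml => /andP [_ h2].
  by rewrite -(ler_pM2l t0); lra.
apply/eqP; rewrite -subr_eq0; apply/eqP/dotv_eq0 => v; rewrite dotvC dotvDr dotvNr.
by have := le0 v; have := le0 (- v); rewrite !dotvNl; lra.
Qed.

(* For negative definite [G s] both functions are partial suprema of the same total
   complementary function [phi s x - V^* s]. *)
Lemma local_double_max : negdefmx (G s0) ->
  exists Xo So : set 'cV[R]_n,
    [/\ nbhs (X s0) Xo, nbhs s0 So, So `<=` Sa_minus A f B b V &
      (forall x, Xo x -> P x <= P (X s0)) <-> (forall s, So s -> D s <= D s0)].
Proof.
move=> neg; have gX := stationary_neg neg; have [c c0 Hc] := negdef_near neg.
have PX : P (X s0) = D s0.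
  by have := @Pi_grad (X s0); rewrite gX PidE//; exact.
pose W := [set s | S s /\ (forall w, c * `|w| ^+ 2 <= - qform (G s) w)].
have nW : nbhs s0 W by exact: filterI hdom Hc.
have Wm : W `<=` Sa_minus A f B b V.
  move=> s [Ss Gs]; split=> // v v0; rewrite -oppr_gt0.
  by apply: lt_le_trans (Gs v); rewrite mulr_gt0// exprn_gt0// normr_gt0.
have W0 s v : W s -> qform (G s) v <= 0.
  move=> [_ Gs]; rewrite -oppr_ge0 (le_trans _ (Gs v))//.
  by rewrite mulr_ge0 ?exprn_ge0// ltW.
have DP s : W s -> D s <= P (X s) by move=> [Ss _]; rewrite PidE//; exact: Pi_ge.
have PD x : W (grad V (L x)) -> P x <= D (grad V (L x)).
  move=> Wx; have Sx := Wx.1; rewrite Pi_grad// PidE// lerD2r.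
  by apply: quadratic_le_xof => // v; exact: W0.
have nX : \forall x \near X s0, W (grad V (L x)).
  by apply: grad_Lam_near => //; rewrite gX.
(* Either [X s0] is a local maximizer and neighborhoods making both sides true are taken, or it is
   not, and the choice of [setT] and [W] makes both sides false. *)
have [[U nU maxU]|nmax] :=
    pselect (exists2 U, nbhs (X s0) U & forall x, U x -> P x <= P (X s0)).
  exists U, (W `&` [set s | U (X s)]); split=> //.
  - by apply: filterI nW (xof_near neg nU).
  - by move=> s [/Wm].
  - split=> // _ s [Ws Us]; rewrite -PX; exact: le_trans (DP s Ws) (maxU _ Us).
exists setT, W; split=> //; first exact: filterT.
split=> [maxT|maxW]; exfalso; apply: nmax.
  by exists setT; [exact: filterT | ].
exists [set x | W (grad V (L x))] => // x Wx.
by rewrite PX (le_trans (PD x Wx))// maxW.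
Qed.

Hypothesis hnonsing : forall x, grad P x = 0 -> \det (hessian P x) != 0.

(** A kernel of [G s0] would produce a singular critical point of [P], reached at some solution [x]
    that need not be [X s0]. *)
Lemma stationary_psd : psdmx (G s0) -> grad V (L (X s0)) = s0.
Proof.
move=> pos; have [xi [_ gxi _]] := VstarE S0.1.
have sol v : exists x eta, [/\ G s0 *m x = F s0,
    linmx B v *m x + lincv b v = - (G s0 *m eta) &
    2^-1 * qform (linmx B v) x + dotv (lincv b v) x = dotv v xi].
  have [d d0 Hd] := near_ray v hdom.
  have Hy t : 0 < t < d -> (G s0 + t *: linmx B v) *m X (s0 + t *: v)
      = F s0 - t *: lincv b v.
    by move=> /Hd St; rewrite -GmDZ -FvDZ xof_solution.
  apply: (@pencil_limit_solution _ _ _ _ _ _ (Gm_sym sA sB s0) (linmx_sym v sB)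
    (fun t => X (s0 + t *: v)) d pos d0 Hy _ _ (xof_solution S0)).
  move=> e e0; have [d1 d10 H1] := quadratic_value_ray v gxi e0.
  by exists d1 => // t /H1; rewrite /total_quadratic GmDZ FvDZ.
have [[k0 [k00 Gk0]]|ker0] := pselect (exists k0 : 'cV[R]_n, k0 != 0 /\ G s0 *m k0 = 0).
  have [x [z [Gx z0 Gz Lx Lz]]] :=
    degenerate_common_zero (Gm_sym sA sB s0) sB k00 Gk0 sol.
  have Lxi : L x = xi.
    apply/eqP; rewrite -subr_eq0; apply/eqP/dotv_eq0 => v.
    by rewrite dotvC dotvDr dotvNr dotv_Lam Lx subrr.
  have dLz : dLam B b x z = 0.
    by apply: dotv_eq0 => v; rewrite dotvC dotv_dLam dotvC Lz.
  have gP : grad P x = 0 by rewrite grad_Pi// Lxi gxi Gx subrr.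
  have := hnonsing gP; rewrite (@singular_hessian_Pi _ _ _ _ _ _ _ _ _ _ x z)//.
    by rewrite eqxx.
  by rewrite Lxi gxi.
(* With trivial kernel, the points obtained for the various [v] all coincide with [X s0]. *)
suff -> : L (X s0) = xi by [].
apply/eqP; rewrite -subr_eq0; apply/eqP/dotv_eq0 => v.
have [x [eta [Gx _ Lx]]] := sol v.
have -> : X s0 = x.
  apply/eqP; rewrite -subr_eq0; apply: contra_notT ker0 => xx0.
  by exists (X s0 - x); split => //; rewrite mulmxBr xof_solution// Gx subrr.
by rewrite dotvC dotvDr dotvNr dotv_Lam Lx subrr.
Qed.

(** Saddle inequalities: [D s <= phi s (X s0) - Vs s <= P (X s0) = D s0] for the dual side, and weak
    duality at [s0] for the primal one. *)
Lemma global_duality : psdmx (G s0) ->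
  (forall x, P (X s0) <= P x) /\
  (forall s, Sa_plus A f B b V s -> D s <= D s0).
Proof.
move=> pos; have gX := stationary_psd pos.
have PX : P (X s0) = phi s0 (X s0) - Vs s0.
  by have := @Pi_grad (X s0); rewrite gX; exact.
split=> [x|s [Ss poss]].
  by rewrite PX (le_trans _ (Pi_ge x S0))// lerD2r quadratic_ge_xof.
rewrite (PidE S0) -PX (PidE Ss); apply: le_trans (Pi_ge (X s0) Ss).
by rewrite lerD2r quadratic_ge_xof.
Qed.

End Duality.

Unset Implicit Arguments.

Theorem theorem2 (R : realType) (n : nat)
    (A : 'M[R]_n) (f : 'cV[R]_n)
    (B : 'I_n -> 'M[R]_n) (b : 'I_n -> 'cV[R]_n)
    (V : 'cV[R]_n -> R) (ginv : 'M[R]_n -> 'M[R]_n)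
    (hA : A \is symmetricmx)
    (hB : forall k, B k \is symmetricmx)
    (hVconv : strictly_convex V)
    (hVC2 : C2 V)
    (hnonsing : forall x : 'cV[R]_n,
        grad (Pi A f B b V) x = 0 -> \det (hessian (Pi A f B b V) x) != 0)
    (hginv : is_ginv ginv)
    (sbar : 'cV[R]_n)
    (hdom : \forall s \near sbar, Sa A f B b V s)
    (hcrit : critical_point (Pid A f B b V ginv) sbar) :
  let xbar := xof A f B b ginv sbar in
  (Sa_plus A f B b V sbar ->
     ((forall x, Pi A f B b V xbar <= Pi A f B b V x) <->
      (forall s, Sa_plus A f B b V s ->
         Pid A f B b V ginv s <= Pid A f B b V ginv sbar))) /\
  (Sa_minus A f B b V sbar ->
     exists (Xo So : set 'cV[R]_n),
       nbhs xbar Xo /\ nbhs sbar So /\ So `<=` Sa_minus A f B b V /\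
       (((forall x, Xo x -> Pi A f B b V xbar <= Pi A f B b V x) <->
         (forall s, So s -> Pid A f B b V ginv sbar <= Pid A f B b V ginv s))
        \/
        ((forall x, Xo x -> Pi A f B b V x <= Pi A f B b V xbar) <->
         (forall s, So s -> Pid A f B b V ginv s <= Pid A f B b V ginv sbar)))).
Proof.
have sA := symmetricmx_tr hA.
have sB k : (B k)^T = B k by exact: symmetricmx_tr.
split=> [[_ pos]|[_ neg]].
  (* Both sides of the equivalence hold, hence so does the equivalence. *)
  by have [minP maxD] := global_duality sA sB hVconv hVC2 hginv hdom hcrit hnonsing pos.
have [Xo [So [nXo nSo SoS iffmax]]] :=
  local_double_max sA sB hVconv hVC2 hginv hdom hcrit neg.
by exists Xo, So; do 3!split=> //; right.
Qed.
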